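(* The lax shuffle decomposition $[1]\otimes_{\mathsf{LG}}(-):\mathrm{Ob}(\Theta)\to\mathrm{Ob}(\omega\text{-}\mathsf{Cat})$ preserves globular sums. That is, for all integers $\ell\ge 0$, $n_0,\dots,n_\ell\ge 0$ and $m_1,\dots,m_\ell\ge 0$ with $n_{i-1}\ge m_i\le n_i$ for all $1\le i\le \ell$, let $$T=\overline{n_0}\underset{\overline{m_1}}{\bigoplus}\overline{n_1}\underset{\overline{m_2}}{\bigoplus}\cdots\underset{\overline{m_\ell}}{\bigoplus}\overline{n_\ell}$$ be the cell of $\Theta$ which is the corresponding globular sum. Then the canonical comparison map $$\bigl([1]\otimes_{\mathsf{LG}}\overline{n_0}\bigr)\underset{[1]\otimes_{\mathsf{LG}}\overline{m_1}}{\bigoplus}\bigl([1]\otimes_{\mathsf{LG}}\overline{n_1}\bigr)\bigoplus\cdots\bigoplus\bigl([1]\otimes_{\mathsf{LG}}\overline{n_{\ell-1}}\bigr)\underset{[1]\otimes_{\mathsf{LG}}\overline{m_\ell}}{\bigoplus}\bigl([1]\otimes_{\mathsf{LG}}\overline{n_\ell}\bigr)\longrightarrow [1]\otimes_{\mathsf{LG}}T$$ is an isomorphism of $\omega$-categories.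
   Context: All $\omega$-categories are strict; $\omega\text{-}\mathsf{Cat}$ is the category of strict $\omega$-categories and strict functors. $[0]$ is the terminal $\omega$-category and $!$ denotes a map to it. **The construction $[n];(C_1,\dots,C_n)$.** For $\omega$-categories $C_1,\dots,C_n$, the $\omega$-category $[n];(C_1,\dots,C_n)$ has objects $0,\dots,n$, $\mathrm{Hom}(i,j)=\prod_{i<k\le j}C_k$ if $i\le j$ (terminal if $i=j$) and $\mathrm{Hom}(i,j)=\varnothing$ if $i>j$, with composition the canonical identifications of products. Write $[n]=[n];([0],\dots,[0])$. An order-preserving $f:[n]\to[m]$ and functors $g_{ji}:C_i\to D_j$ for $1\le i\le n$, $f(i-1)<j\le f(i)$, define a functor $f;(g):[n];(C_i)\to[m];(D_j)$ which is $f$ on objects and $(g_{ji})_j:C_i\to\prod_{f(i-1)<j\le f(i)}D_j$ on $\mathrm{Hom}(i-1,i)$. The cells of $\Theta$ are the $\omega$-categories obtained from $[0]$ by iterating: if $A_1,\dots,A_n$ ($n\ge0$) are cells then so is $[n];(A_1,\dots,A_n)$. $\Theta$ is the full subcategory of $\omega\text{-}\mathsf{Cat}$ on the cells; every cell is uniquely of the form $[n];(A_1,\dots,A_n)$. Globes: $\overline 0=[0]$, $\overline{n+1}=[1];(\overline n)$. $d^k:[n]\to[n+1]$ is the order-preserving injection omitting $k$. **The cylinder.** Define recursively, for each cell $T=[n];(A_1,\dots,A_n)$, an $\omega$-category $[1]\otimes_{\mathsf{LG}}T$ and functors $\{0\}\otimes_{\mathsf{LG}}T,\ \{1\}\otimes_{\mathsf{LG}}T:T\to[1]\otimes_{\mathsf{LG}}T$.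 Put $P_j=[n+1];(A_1,\dots,A_j,[0],A_{j+1},\dots,A_n)$ for $0\le j\le n$, and $Q_k=[n];(A_1,\dots,A_{k-1},[1]\otimes_{\mathsf{LG}}A_k,A_{k+1},\dots,A_n)$ for $1\le k\le n$. Then $[1]\otimes_{\mathsf{LG}}T$ is the colimit in $\omega\text{-}\mathsf{Cat}$ of the zigzag $$P_0\leftarrow T\to Q_1\leftarrow T\to P_1\leftarrow T\to Q_2\leftarrow T\to\cdots\to Q_n\leftarrow T\to P_n,$$ where, for each $k$: the map $T\to P_{k-1}$ is $d^k;(\mathrm{id},\dots,(!,\mathrm{id}_{A_k}),\dots,\mathrm{id})$; the next map $T\to Q_k$ (same copy of $T$) is $\mathrm{id};(\mathrm{id},\dots,\{1\}\otimes_{\mathsf{LG}}A_k,\dots,\mathrm{id})$; the other map $T\to Q_k$ is $\mathrm{id};(\mathrm{id},\dots,\{0\}\otimes_{\mathsf{LG}}A_k,\dots,\mathrm{id})$; and the map $T\to P_k$ (from that same copy of $T$) is $d^k;(\mathrm{id},\dots,(\mathrm{id}_{A_k},!),\dots,\mathrm{id})$. The functor $\{1\}\otimes_{\mathsf{LG}}T$ is $T\xrightarrow{d^0;(\mathrm{id},\dots,\mathrm{id})}P_0\to[1]\otimes_{\mathsf{LG}}T$ and $\{0\}\otimes_{\mathsf{LG}}T$ is $T\xrightarrow{d^{n+1};(\mathrm{id},\dots,\mathrm{id})}P_n\to[1]\otimes_{\mathsf{LG}}T$. In particular $[1]\otimes_{\mathsf{LG}}[0]=[1]$, with $\{0\}\otimes_{\mathsf{LG}}[0]$,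 $\{1\}\otimes_{\mathsf{LG}}[0]$ the objects $0,1$. **Action on globular inclusions.** A globular inclusion $u:[n];(A_i)\to[m];(B_j)$ is a map of the form $f;(g_1,\dots,g_n)$ with $f(i)=p+i$ for some $p$ and each $g_i:A_i\to B_{p+i}$ (recursively) a globular inclusion (for $n=0$: any object of $[m];(B_j)$). It induces $[1]\otimes_{\mathsf{LG}}u$ by sending $P_j$ of the source to $P_{p+j}$ of the target and $Q_k$ to $Q_{p+k}$, each by the map which is $i\mapsto p+i$ on objects and is given componentwise by the $g_i$, by $\mathrm{id}_{[0]}$, and by $[1]\otimes_{\mathsf{LG}}g_k$ on the $k$-th component of $Q_k$. **Globular sums.** The iterated source and target inclusions $s,t:\overline m\to\overline n$ ($m\le n$) are defined by: for $m=n$ both are the identity; for $0=m<n$, $s$ (resp. $t$) is the object $0$ (resp. $1$); for $0<m<n$ they are $[1];(s)$, $[1];(t)$. The globular sum $\overline{n_0}\oplus_{\overline{m_1}}\cdots\oplus_{\overline{m_\ell}}\overline{n_\ell}$ is the colimit of $\overline{n_0}\xleftarrow{t}\overline{m_1}\xrightarrow{s}\overline{n_1}\xleftarrow{t}\cdots\xrightarrow{s}\overline{n_\ell}$; it is a cell, and the maps $\overline{n_i}\to T$ are globular inclusions. The symbol $\bigoplus$ between cylinders denotes the colimit in $\omega\text{-}\mathsf{Cat}$ of the diagram $$[1]\otimes_{\mathsf{LG}}\overline{n_0}\xleftarrow{[1]\otimes_{\mathsf{LG}}t}[1]\otimes_{\mathsf{LG}}\overline{m_1}\xrightarrow{[1]\otimes_{\mathsf{LG}}s}[1]\otimes_{\mathsf{LG}}\overline{n_1}\xleftarrow{[1]\otimes_{\mathsf{LG}}t}\cdots\xrightarrow{[1]\otimes_{\mathsf{LG}}s}[1]\otimes_{\mathsf{LG}}\overline{n_\ell}$$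 obtained by applying $[1]\otimes_{\mathsf{LG}}(-)$ to the zigzag $\overline{n_0}\xleftarrow{t}\overline{m_1}\xrightarrow{s}\overline{n_1}\xleftarrow{t}\cdots\xrightarrow{s}\overline{n_\ell}$, and the comparison map is induced by the functors $[1]\otimes_{\mathsf{LG}}(\overline{n_i}\to T)$. *)

(* Defs.v *)
From mathcomp Require Import all_boot.
From mathcomp Require Import boolp.
From mathcomp Require Import zify.

Set Implicit Arguments.
Unset Strict Implicit.
Unset Printing Implicit Defensive.

(** Single-sorted presentation (Street, Steiner): an element is a cell of
    arbitrary finite dimension, identified with all the identities on it, and
    the cells of dimension at most [k] are the fixed points of [bd false k]
    (equivalently, of [bd true k]).
    - [bd false k x], [bd true k x]: the [k]-dimensional source and target of x.
    - [comp k x y]: the composite along dimension [k], [x] first.  It is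
      meaningful only if [x] and [y] are [k]-composable; other values are junk,
      constrained by no axiom and ignored by functors. *)
Record omegaCat := OmegaCat {
  carrier :> Type;
  bd : bool -> nat -> carrier -> carrier;
  comp : nat -> carrier -> carrier -> carrier;
  bd_bd : forall a b j k x,
    bd a j (bd b k x) = if j < k then bd a j x else bd b k x;
  comp_idl : forall k x, comp k (bd false k x) x = x;
  comp_idr : forall k x, comp k x (bd true k x) = x;
  bd_comp_src : forall k x y, bd true k x = bd false k y ->
    bd false k (comp k x y) = bd false k x;
  bd_comp_tgt : forall k x y, bd true k x = bd false k y ->
    bd true k (comp k x y) = bd true k y;
  bd_comp : forall a j k x y, j != k -> bd true k x = bd false k y ->
    bd a j (comp k x y) = comp k (bd a j x) (bd a j y);
  comp_assoc : forall k x y z,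
    bd true k x = bd false k y -> bd true k y = bd false k z ->
    comp k (comp k x y) z = comp k x (comp k y z);
  interchange : forall j k x y z w, j < k ->
    bd true k x = bd false k y -> bd true k z = bd false k w ->
    bd true j (comp k x y) = bd false j (comp k z w) ->
    comp j (comp k x y) (comp k z w) = comp k (comp j x z) (comp j y w);
  fin_dim : forall x, exists k, bd false k x = x
}.

Definition composable (C : omegaCat) k (x y : C) : Prop :=
  bd true k x = bd false k y.

Record functor (C D : omegaCat) := Functor {
  fmap :> C -> D;
  fmap_bd : forall a k x, fmap (bd a k x) = bd a k (fmap x);
  fmap_comp : forall k x y, composable k x y ->
    fmap (comp k x y) = comp k (fmap x) (fmap y)
}.

Definition is_iso (C D : omegaCat) (F : functor C D) : Prop :=
  exists G : functor D C, cancel F G /\ cancel G F.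

Definition idF (C : omegaCat) : functor C C :=
  @Functor C C id (fun _ _ _ => erefl) (fun _ _ _ _ => erefl).

Lemma compF_comp (C D E : omegaCat) (G : functor D E) (F : functor C D) k x y :
  composable k x y -> G (F (comp k x y)) = comp k (G (F x)) (G (F y)).
Proof.
move=> h; rewrite fmap_comp // fmap_comp //.
by rewrite /composable -!fmap_bd h.
Qed.

Definition compF (C D E : omegaCat) (G : functor D E) (F : functor C D) :
    functor C E :=
  @Functor C E (fun x => G (F x))
    (fun a k x => etrans (congr1 G (fmap_bd F a k x)) (fmap_bd G a k (F x)))
    (@compF_comp C D E G F).

Section OmegaCatTheory.
Variable C : omegaCat.
Implicit Types x y : C.

Lemma bd_lt a b j k x : j < k -> bd a j (bd b k x) = bd a j x.
Proof. by move=> h; rewrite bd_bd h. Qed.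

Lemma bd_ge a b j k x : k <= j -> bd a j (bd b k x) = bd b k x.
Proof. by move=> h; rewrite bd_bd ltnNge h. Qed.

Lemma bd_fix a b j k x : bd a k x = x -> k <= j -> bd b j x = x.
Proof. by move=> <- h; rewrite bd_ge. Qed.

End OmegaCatTheory.

Section Ordinals.
Variable n : nat.

(** The component of index [k : 'I_n] joins the object [lo k] to [hi k]; thus
    [C k] is the entry C_(k+1) of [n];(C_1,...,C_n). *)
Definition lo (k : 'I_n) : 'I_n.+1 := widen_ord (leqnSn n) k.
Definition hi (k : 'I_n) : 'I_n.+1 := lift ord0 k.

Lemma loE k : lo k = k :> nat. Proof. by []. Qed.
Lemma hiE k : hi k = k.+1 :> nat. Proof. exact: lift0. Qed.

End Ordinals.

Section Wedge.
Variables (n : nat) (C : 'I_n -> omegaCat).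

Record wcell := WCell {
  wsrc : 'I_n.+1;
  wtgt : 'I_n.+1;
  wle : wsrc <= wtgt;
  wval : forall k : 'I_n, wsrc <= k < wtgt -> C k
}.

Lemma wcell_eq (X Y : wcell) :
  wsrc X = wsrc Y -> wtgt X = wtgt Y ->
  (forall k hX hY, @wval X k hX = @wval Y k hY) -> X = Y.
Proof.
case: X => s t le v; case: Y => s' t' le' v' /= es et.
case: _ / es le' v' => le' v'; case: _ / et le' v' => le' v' ev.
have -> : le' = le by apply: bool_irrelevance.
congr WCell; apply: functional_extensionality_dep => k.
by apply: functional_extensionality_dep => h.
Qed.

Lemma wval_irr (X : wcell) k h h' : @wval X k h = @wval X k h'.
Proof. by congr wval; apply: bool_irrelevance. Qed.

Lemma wval_eq (X Y : wcell) : X = Y ->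
  forall k hX hY, @wval X k hX = @wval Y k hY.
Proof. by move=> -> *; apply: wval_irr. Qed.

Lemma wobj_val_subproof (i : 'I_n.+1) (k : 'I_n) : i <= k < i -> C k.
Proof. by move/andP=> [h1 h2]; move: (leq_trans h2 h1); rewrite ltnn. Qed.

(** The object [i], seen as the unique element of [Hom(i,i)]. *)
Definition wobj (i : 'I_n.+1) : wcell :=
  WCell (leqnn i) (@wobj_val_subproof i).

Definition wbd (a : bool) (d : nat) (X : wcell) : wcell :=
  if d is d'.+1 then WCell (wle X) (fun k h => bd a d' (@wval X k h))
  else wobj (if a then wtgt X else wsrc X).

Lemma comp0_le (X Y : wcell) : wtgt X = wsrc Y -> wsrc X <= wtgt Y.
Proof. by move=> e; apply: leq_trans (wle X) _; rewrite e; apply: wle. Qed.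

Lemma comp0_l (X Y : wcell) (k : 'I_n) :
  wsrc X <= k < wtgt Y -> k < wtgt X -> wsrc X <= k < wtgt X.
Proof. by move=> /andP [-> _] ->. Qed.

Lemma comp0_r (X Y : wcell) (k : 'I_n) : wtgt X = wsrc Y ->
  wsrc X <= k < wtgt Y -> ~ (k < wtgt X) -> wsrc Y <= k < wtgt Y.
Proof. by move=> <- /andP [_ ->] /negP; rewrite -leqNgt => ->. Qed.

(** Composition along objects: concatenation of tuples. *)
Definition wcomp0 (X Y : wcell) (e : wtgt X = wsrc Y) : wcell :=
  WCell (comp0_le e) (fun k h =>
    match @idP (k < wtgt X) with
    | ReflectT p => wval (comp0_l h p)
    | ReflectF p => wval (comp0_r e h p)
    end).

(** The [k]-th entry of [X], or [d] if [X] has none. *)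
Definition wat (X : wcell) (k : 'I_n) (d : C k) : C k :=
  match @idP (wsrc X <= k < wtgt X) with
  | ReflectT p => wval p
  | ReflectF _ => d
  end.

(** Composition along dimension [d'.+1]: componentwise.  Composable [X] and [Y]
    have the same endpoints, so that the default value of [wat] is not used. *)
Definition wcomp (d : nat) (X Y : wcell) : wcell :=
  if d is d'.+1 then
    WCell (wle X) (fun k h => comp d' (wval h) (wat Y (wval h)))
  else
    match @eqP _ (wtgt X) (wsrc Y) with
    | ReflectT e => wcomp0 e
    | ReflectF _ => X
    end.

Lemma watE (X : wcell) k d h : @wat X k d = @wval X k h.
Proof. by rewrite /wat; case: {-}_ / idP => // h'; apply: wval_irr. Qed.

Lemma wcomp0E (X Y : wcell) (e : wtgt X = wsrc Y) : wcomp 0 X Y = wcomp0 e.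
Proof.
rewrite /wcomp; case: {-}_ / eqP => // e'.
by congr wcomp0; apply: Prop_irrelevance.
Qed.

Lemma wcomp0_vall (X Y : wcell) (e : wtgt X = wsrc Y) k h h' :
  @wval (wcomp0 e) k h = @wval X k h'.
Proof.
rewrite /=; case: {-}_ / idP => [p|p]; first exact: wval_irr.
by exfalso; apply: p; case/andP: (h').
Qed.

Lemma wcomp0_valr (X Y : wcell) (e : wtgt X = wsrc Y) k h h' :
  @wval (wcomp0 e) k h = @wval Y k h'.
Proof.
rewrite /=; case: {-}_ / idP => [p|p]; last exact: wval_irr.
by exfalso; case/andP: (h') => h'' _; move: p; rewrite e ltnNge h''.
Qed.

Lemma composable0 (X Y : wcell) :
  wbd true 0 X = wbd false 0 Y -> wtgt X = wsrc Y.
Proof. by move/(congr1 wsrc). Qed.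

Lemma composableS d (X Y : wcell) : wbd true d.+1 X = wbd false d.+1 Y ->
  [/\ wsrc X = wsrc Y, wtgt X = wtgt Y
    & forall k hX hY, bd true d (@wval X k hX) = bd false d (@wval Y k hY)].
Proof.
move=> e; split; [exact: (congr1 wsrc e) | exact: (congr1 wtgt e) |].
by move=> k hX hY; exact: (@wval_eq _ _ e k hX hY).
Qed.

Lemma wcompS_val d (X Y : wcell) k h hX hY :
  @wval (wcomp d.+1 X Y) k h = comp d (@wval X k hX) (@wval Y k hY).
Proof. by rewrite /= (watE _ hY) (@wval_irr X _ h hX). Qed.

Lemma wcomp0_case (X Y : wcell) (e : wtgt X = wsrc Y) (k : 'I_n) :
  wsrc X <= k < wtgt Y -> wsrc X <= k < wtgt X \/ wsrc Y <= k < wtgt Y.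
Proof.
case/andP=> h1 h2; case: (ltnP k (wtgt X)) => h; [left | right].
  by rewrite h1.
by rewrite -e h.
Qed.

Lemma wbd_bd a b j k X :
  wbd a j (wbd b k X) = if j < k then wbd a j X else wbd b k X.
Proof.
case: j k => [|j] [|k] //=; try by case: a; case: b.
  by apply: wcell_eq => //= i h; case/andP: (h) => h1 h2; lia.
rewrite ltnS; case: ifP => h; apply: wcell_eq => //= i h1 h2;
  by rewrite bd_bd h (bool_irrelevance h1 h2).
Qed.

Lemma wcomp_idl k X : wcomp k (wbd false k X) X = X.
Proof.
case: k => [|k].
  have e : wtgt (wbd false 0 X) = wsrc X by [].
  rewrite (wcomp0E e); apply: wcell_eq => // k hX hY.
  exact: wcomp0_valr.
apply: wcell_eq => // i hX hY.
by rewrite (@wcompS_val _ _ _ _ hX hY hY) /= comp_idl.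
Qed.

Lemma wcomp_idr k X : wcomp k X (wbd true k X) = X.
Proof.
case: k => [|k].
  have e : wtgt X = wsrc (wbd true 0 X) by [].
  rewrite (wcomp0E e); apply: wcell_eq => // k hX hY.
  exact: wcomp0_vall.
apply: wcell_eq => // i hX hY.
by rewrite (@wcompS_val _ _ _ _ hX hY hY) /= comp_idr.
Qed.

Lemma wbd_comp_src k X Y : wbd true k X = wbd false k Y ->
  wbd false k (wcomp k X Y) = wbd false k X.
Proof.
case: k => [|k].
  by move/composable0 => e; rewrite (wcomp0E e).
case/composableS => es et ev; apply: wcell_eq => // i hX hY.
have hY' : wsrc Y <= i < wtgt Y by rewrite -es -et.
have -> : wval hX = bd false k (comp k (@wval X i hY) (@wval Y i hY')).
  by rewrite -(@wcompS_val k X Y i hX).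
by rewrite bd_comp_src.
Qed.

Lemma wbd_comp_tgt k X Y : wbd true k X = wbd false k Y ->
  wbd true k (wcomp k X Y) = wbd true k Y.
Proof.
case: k => [|k].
  by move/composable0 => e; rewrite (wcomp0E e).
case/composableS => es et ev; apply: wcell_eq => // i hX hY.
have -> : wval hX = bd true k (comp k (@wval X i hX) (@wval Y i hY)).
  by rewrite -(@wcompS_val k X Y i hX).
by rewrite bd_comp_tgt.
Qed.

Lemma wbd_compN a j k X Y : j != k -> wbd true k X = wbd false k Y ->
  wbd a j (wcomp k X Y) = wcomp k (wbd a j X) (wbd a j Y).
Proof.
case: k => [|k].
  case: j => // j _ /composable0 e.
  have e' : wtgt (wbd a j.+1 X) = wsrc (wbd a j.+1 Y) by [].
  rewrite (wcomp0E e) (wcomp0E e'); apply: wcell_eq => // i hX hY.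
  have -> : wval hX = bd a j (@wval (wcomp0 e) i hX) by [].
  have [h|h] := wcomp0_case e hX.
    by rewrite (@wcomp0_vall _ _ e' _ hY h) (@wcomp0_vall _ _ e _ hX h).
  by rewrite (@wcomp0_valr _ _ e' _ hY h) (@wcomp0_valr _ _ e _ hX h).
case: j => [|j] jk /composableS [es et ev].
  apply: wcell_eq => //=; try by case: a.
  by move=> i hX; case/andP: (hX) => h1 h2; lia.
apply: wcell_eq => // i hX hY.
have hY' : wsrc Y <= i < wtgt Y by rewrite -es -et.
rewrite (@wcompS_val k (wbd a j.+1 X) (wbd a j.+1 Y) i hY hX hY').
have -> : wval hX = bd a j (comp k (@wval X i hX) (@wval Y i hY')).
  by rewrite -(@wcompS_val k X Y i hX).
by rewrite bd_comp.
Qed.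

Lemma wcomp_assoc k X Y Z :
  wbd true k X = wbd false k Y -> wbd true k Y = wbd false k Z ->
  wcomp k (wcomp k X Y) Z = wcomp k X (wcomp k Y Z).
Proof.
case: k => [|k].
  move=> /composable0 e /composable0 e'.
  have f : wtgt (wcomp0 e) = wsrc Z by [].
  have f' : wtgt X = wsrc (wcomp0 e') by [].
  rewrite (wcomp0E e) (wcomp0E e') (wcomp0E f) (wcomp0E f').
  apply: wcell_eq => // i h1 h2.
  have [h|h] := wcomp0_case f h1.
    rewrite (@wcomp0_vall _ _ f _ h1 h).
    have [h'|h'] := wcomp0_case e h; [rewrite (@wcomp0_vall _ _ e _ h h') | rewrite (@wcomp0_valr _ _ e _ h h')].
      by rewrite (@wcomp0_vall _ _ f' _ h2 h').
    have h3 : wsrc Y <= i < wtgt Z.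
      by case/andP: (h') => -> _ /=; case/andP: (h2).
    by rewrite (@wcomp0_valr _ _ f' _ h2 h3) (@wcomp0_vall _ _ e' _ h3 h').
  rewrite (@wcomp0_valr _ _ f _ h1 h).
  have h3 : wsrc Y <= i < wtgt Z.
    by case/andP: (h) => h' ->; rewrite (leq_trans (wle Y)) // e' h'.
  by rewrite (@wcomp0_valr _ _ f' _ h2 h3) (@wcomp0_valr _ _ e' _ h3 h).
case/composableS => es et ev /composableS [es' et' ev'].
apply: wcell_eq => // i hX hX'.
have hY : wsrc Y <= i < wtgt Y by rewrite -es -et.
have hZ : wsrc Z <= i < wtgt Z by rewrite -es' -et'.
rewrite (@wcompS_val k (wcomp k.+1 X Y) Z i hX hX hZ).
rewrite (@wcompS_val k X Y i hX hX hY).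
rewrite (@wcompS_val k X (wcomp k.+1 Y Z) i hX' hX hY).
by rewrite (@wcompS_val k Y Z i hY hY hZ) comp_assoc.
Qed.

Lemma winterchange j k X Y Z W : j < k ->
  wbd true k X = wbd false k Y -> wbd true k Z = wbd false k W ->
  wbd true j (wcomp k X Y) = wbd false j (wcomp k Z W) ->
  wcomp j (wcomp k X Y) (wcomp k Z W) = wcomp k (wcomp j X Z) (wcomp j Y W).
Proof.
case: k => // k jk /composableS [es et ev] /composableS [es' et' ev'].
case: j jk => [_|j jk].
  move=> /composable0 f.
  have f1 : wtgt X = wsrc Z by [].
  have f2 : wtgt Y = wsrc W by rewrite -et -es'.
  rewrite (wcomp0E f) (wcomp0E f1) (wcomp0E f2).
  apply: wcell_eq => // i h1 h2.
  have h3 : wsrc Y <= i < wtgt W by rewrite -es -et'.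
  rewrite (@wcompS_val k (wcomp0 f1) (wcomp0 f2) i h2 h2 h3).
  have [h|h] := wcomp0_case f h1.
    rewrite (@wcomp0_vall _ _ f _ h1 h).
    have h' : wsrc Y <= i < wtgt Y by rewrite -es -et.
    rewrite (@wcompS_val k X Y i h h h').
    by rewrite (@wcomp0_vall _ _ f1 _ h2 h) (@wcomp0_vall _ _ f2 _ h3 h').
  rewrite (@wcomp0_valr _ _ f _ h1 h).
  have h' : wsrc W <= i < wtgt W by rewrite -es' -et'.
  rewrite (@wcompS_val k Z W i h h h').
  by rewrite (@wcomp0_valr _ _ f1 _ h2 h) (@wcomp0_valr _ _ f2 _ h3 h').
move=> /composableS [/= fs ft fv].
apply: wcell_eq => // i hX hX'.
have hY : wsrc Y <= i < wtgt Y by rewrite -es -et.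
have hZ : wsrc Z <= i < wtgt Z by rewrite -fs -ft.
have hW : wsrc W <= i < wtgt W by rewrite -es' -et'.
rewrite (@wcompS_val j (wcomp k.+1 X Y) (wcomp k.+1 Z W) i hX hX hZ).
rewrite (@wcompS_val k X Y i hX hX hY) (@wcompS_val k Z W i hZ hZ hW).
rewrite (@wcompS_val k (wcomp j.+1 X Z) (wcomp j.+1 Y W) i hX' hX hY).
rewrite (@wcompS_val j X Z i hX hX hZ) (@wcompS_val j Y W i hY hY hW).
rewrite interchange //.
have := fv i hX hZ.
by rewrite (watE _ hY) (watE _ hW).
Qed.

Lemma wfin_dim X : exists k, wbd false k X = X.
Proof.
have bnd i : exists k, forall h, bd false k (@wval X i h) = @wval X i h.
  case: (pselect (wsrc X <= i < wtgt X)) => [h|nh]; last by exists 0.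
  have [k hk] := fin_dim (@wval X i h).
  by exists k => h'; rewrite (wval_irr h' h).
have [f hf] := choice bnd.
exists (\max_i f i).+1; apply: wcell_eq => //= i h1 h2.
rewrite (bool_irrelevance h2 h1).
by apply: bd_fix (hf i h1) _; apply: leq_bigmax.
Qed.

Definition wedge : omegaCat :=
  OmegaCat wbd_bd wcomp_idl wcomp_idr wbd_comp_src wbd_comp_tgt wbd_compN
    wcomp_assoc winterchange wfin_dim.

End Wedge.

Section WedgeMap.
Variables (n m : nat) (C : 'I_n -> omegaCat) (D : 'I_m -> omegaCat).
Variables (f : 'I_n.+1 -> 'I_m.+1).
Hypothesis fm : forall i j : 'I_n.+1, i <= j -> f i <= f j.
Variable g : forall (i : 'I_n) (j : 'I_m),
  f (lo i) <= j < f (hi i) -> functor (C i) (D j).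

Lemma seg_ex (a b : 'I_n.+1) (j : 'I_m) : f a <= j < f b ->
  exists i : 'I_n, (a <= i < b) && (f (lo i) <= j < f (hi i)).
Proof.
move=> h; have hab : a <= b.
  by rewrite leqNgt; apply/negP => /ltnW /fm hba; move: h; lia.
move: {2}(b - a) (erefl (b - a)) => k; elim: k b h hab => [|k IH] b h hab e.
  have eab : b = a by apply: ord_inj; lia.
  by move: h; rewrite eab; lia.
have hb : b.-1 < n by have := ltn_ord b; lia.
have hi_b : hi (Ordinal hb) = b by apply: ord_inj; rewrite hiE /=; lia.
case: (leqP (f (lo (Ordinal hb))) j) => hj.
  exists (Ordinal hb); rewrite hi_b hj; case/andP: h => _ -> /=; lia.
have h' : f a <= j < f (lo (Ordinal hb)) by case/andP: h => -> _.
have hab' : a <= lo (Ordinal hb) by rewrite loE /=; lia.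
have e' : lo (Ordinal hb) - a = k by rewrite loE /=; lia.
have [i /andP [h1 h2]] := IH _ h' hab' e'.
by exists i; rewrite h2 andbT; move: h1; rewrite loE /=; lia.
Qed.

(** The component [i] of the source lying over the component [j]. *)
Definition seg (a b : 'I_n.+1) (j : 'I_m) (h : f a <= j < f b) :
  {i : 'I_n | (a <= i < b) && (f (lo i) <= j < f (hi i))} := sigW (seg_ex h).

Lemma seg_dom (a b : 'I_n.+1) (j : 'I_m) (h : f a <= j < f b) :
  a <= sval (seg h) < b.
Proof. by case: (seg h) => i /= /andP []. Qed.

Lemma seg_over (a b : 'I_n.+1) (j : 'I_m) (h : f a <= j < f b) :
  f (lo (sval (seg h))) <= j < f (hi (sval (seg h))).
Proof. by case: (seg h) => i /= /andP []. Qed.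

Lemma seg_uniq (i i' : 'I_n) (j : 'I_m) :
  f (lo i) <= j < f (hi i) -> f (lo i') <= j < f (hi i') -> i = i'.
Proof.
move=> h h'; apply: ord_inj; case: (ltngtP i i') => // hlt.
- have := @fm (hi i) (lo i'); rewrite hiE loE => /(_ hlt); lia.
- have := @fm (hi i') (lo i); rewrite hiE loE => /(_ hlt); lia.
Qed.

Definition wmap (X : wcell C) : wcell D :=
  WCell (fm (wle X)) (fun j h =>
    g (seg_over h) (wval (seg_dom h))).

Lemma wmap_val (X : wcell C) (i : 'I_n) (j : 'I_m) h hi' (hX : wsrc X <= i < wtgt X) :
  @wval _ _ (wmap X) j h = @g i j hi' (wval hX).
Proof.
rewrite /=; move: (seg_over h) (seg_dom h).
have e : sval (seg h) = i by apply: seg_uniq (seg_over h) hi'.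
rewrite e => h1 h2; rewrite (bool_irrelevance h1 hi'); congr (fmap _ _).
exact: wval_irr.
Qed.

Lemma wmap_dom (X : wcell C) (j : 'I_m) : f (wsrc X) <= j < f (wtgt X) ->
  exists (i : 'I_n) (_ : f (lo i) <= j < f (hi i)), wsrc X <= i < wtgt X.
Proof. by move=> h; exists (sval (seg h)), (seg_over h); apply: seg_dom. Qed.

Lemma wmap_bd a k (X : wedge C) : wmap (bd a k X) = bd a k (wmap X : wedge D).
Proof.
case: k => [|k]; apply: wcell_eq => //; try by case: a.
  by move=> j h; exfalso; move: (h) => /=; case: (a) => /=; lia.
move=> j h h'.
have [i [hi' hX]] := wmap_dom h'.
rewrite (@wmap_val (bd a k.+1 X) i j h hi' hX).
have -> : wval h' = bd a k (@wval _ _ (wmap X) j h') by [].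
by rewrite (@wmap_val X i j h' hi' hX) -fmap_bd.
Qed.

Lemma wmap_comp k (X Y : wedge C) : composable k X Y ->
  wmap (comp k X Y) = comp k (wmap X : wedge D) (wmap Y : wedge D).
Proof.
case: k => [|k].
  move/composable0 => e.
  have e' : wtgt (wmap X) = wsrc (wmap Y) by rewrite /= e.
  have -> : comp 0 X Y = wcomp0 e by apply: wcomp0E.
  have -> : comp 0 (wmap X : wedge D) (wmap Y) = wcomp0 e' by apply: wcomp0E.
  apply: wcell_eq => // j h h'.
  have [i [hi' hXY]] := wmap_dom (h : f (wsrc (wcomp0 e)) <= j < f (wtgt (wcomp0 e))).
  rewrite (@wmap_val _ i j h hi' hXY).
  have [hX|hX] := wcomp0_case e hXY.
    have hj : f (wsrc X) <= j < f (wtgt X).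
      have := @fm (wsrc X) (lo i); have := @fm (hi i) (wtgt X).
      by rewrite hiE loE; lia.
    by rewrite (@wcomp0_vall _ _ _ _ e' _ h' hj) (@wmap_val _ i j hj hi' hX)
               (@wcomp0_vall _ _ _ _ e _ hXY hX).
  have hj : f (wsrc Y) <= j < f (wtgt Y).
    have := @fm (wsrc Y) (lo i); have := @fm (hi i) (wtgt Y).
    by rewrite hiE loE; lia.
  by rewrite (@wcomp0_valr _ _ _ _ e' _ h' hj) (@wmap_val _ i j hj hi' hX)
             (@wcomp0_valr _ _ _ _ e _ hXY hX).
case/composableS => es et ev; apply: wcell_eq => // j h h'.
have [i [hi' hX]] := wmap_dom (h : f (wsrc X) <= j < f (wtgt X)).
have hY : wsrc Y <= i < wtgt Y by rewrite -es -et.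
have hj : f (wsrc Y) <= j < f (wtgt Y) by rewrite -es -et.
rewrite (@wmap_val _ i j h hi' hX) (@wcompS_val _ _ k X Y i hX hX hY).
rewrite (@wcompS_val _ _ k (wmap X) (wmap Y) j h' h' hj).
by rewrite fmap_comp ?(@wmap_val X i j _ hi' hX) ?(@wmap_val Y i j _ hi' hY) //; apply: ev.
Qed.

(** The functor [f;(g)]. *)
Definition wedge_map : functor (wedge C) (wedge D) :=
  @Functor (wedge C) (wedge D) wmap wmap_bd wmap_comp.

End WedgeMap.

(** Diagrams of spans [dX (dl j) <- dY j -> dX (dr j)]; zigzags are a special
    case.  Since every object [dY j] maps to some [dX i], a cocone is determined
    by its components on the [dX i]. *)
Record spanDiagram := SpanDiagram {
  dI : Type;
  dJ : Type;
  dX : dI -> omegaCat;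
  dY : dJ -> omegaCat;
  dl : dJ -> dI;
  dr : dJ -> dI;
  dlm : forall j, functor (dY j) (dX (dl j));
  drm : forall j, functor (dY j) (dX (dr j))
}.

Definition is_cocone (D : spanDiagram) (E : omegaCat)
    (c : forall i : dI D, functor (dX i) E) : Prop :=
  forall (j : dJ D) (y : dY j), c (dl j) (dlm j y) = c (dr j) (drm j y).

Definition is_colimit (D : spanDiagram) (E : omegaCat)
    (c : forall i : dI D, functor (dX i) E) : Prop :=
  [/\ is_cocone c,
      (forall (E' : omegaCat) (c' : forall i : dI D, functor (dX i) E'),
         is_cocone c' ->
         exists h : functor E E', forall i, compF h (c i) =1 c' i)
    & (forall (E' : omegaCat) (h h' : functor E E'),
         (forall i, compF h (c i) =1 compF h' (c i)) -> h =1 h')].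

(** A chosen colimit, as a quotient of the formal composites of cells of the
    [dX i].  The partial equivalence relation [teq] is the least one imposing
    the axioms and the gluing; [teq t t] says that [t] is well formed. *)
Section Colimit.
Variable D : spanDiagram.

Inductive term :=
| tgen (i : dI D) of dX i
| tbd of bool & nat & term
| tcomp of nat & term & term.

Inductive teq : term -> term -> Prop :=
| teq_gen i (x : dX i) : teq (tgen x) (tgen x)
| teq_sym t u : teq t u -> teq u t
| teq_trans t u v : teq t u -> teq u v -> teq t v
| teq_bd a k t t' : teq t t' -> teq (tbd a k t) (tbd a k t')
| teq_comp k t t' u u' : teq t t' -> teq u u' ->
    teq (tbd true k t) (tbd false k u) -> teq (tcomp k t u) (tcomp k t' u')
| teq_glue (j : dJ D) (y : dY j) : teq (tgen (dlm j y)) (tgen (drm j y))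
| teq_gen_bd a k i (x : dX i) : teq (tgen (bd a k x)) (tbd a k (tgen x))
| teq_gen_comp k i (x y : dX i) : composable k x y ->
    teq (tgen (comp k x y)) (tcomp k (tgen x) (tgen y))
| teq_bd_bd a b j k t : teq t t ->
    teq (tbd a j (tbd b k t)) (if j < k then tbd a j t else tbd b k t)
| teq_idl k t : teq t t -> teq (tcomp k (tbd false k t) t) t
| teq_idr k t : teq t t -> teq (tcomp k t (tbd true k t)) t
| teq_bd_comp_src k t u : teq t t -> teq u u ->
    teq (tbd true k t) (tbd false k u) ->
    teq (tbd false k (tcomp k t u)) (tbd false k t)
| teq_bd_comp_tgt k t u : teq t t -> teq u u ->
    teq (tbd true k t) (tbd false k u) ->
    teq (tbd true k (tcomp k t u)) (tbd true k u)
| teq_bd_comp a j k t u : j != k -> teq t t -> teq u u ->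
    teq (tbd true k t) (tbd false k u) ->
    teq (tbd a j (tcomp k t u)) (tcomp k (tbd a j t) (tbd a j u))
| teq_assoc k t u v : teq t t -> teq u u -> teq v v ->
    teq (tbd true k t) (tbd false k u) -> teq (tbd true k u) (tbd false k v) ->
    teq (tcomp k (tcomp k t u) v) (tcomp k t (tcomp k u v))
| teq_interchange j k t u v w : j < k ->
    teq t t -> teq u u -> teq v v -> teq w w ->
    teq (tbd true k t) (tbd false k u) -> teq (tbd true k v) (tbd false k w) ->
    teq (tbd true j (tcomp k t u)) (tbd false j (tcomp k v w)) ->
    teq (tcomp j (tcomp k t u) (tcomp k v w))
        (tcomp k (tcomp j t v) (tcomp j u w)).

Lemma teq_refll t u : teq t u -> teq t t.
Proof. by move=> h; apply: teq_trans h (teq_sym h). Qed.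

Lemma teq_reflr t u : teq t u -> teq u u.
Proof. by move=> h; apply: teq_trans (teq_sym h) h. Qed.

Fixpoint twf (t : term) : Prop :=
  match t with
  | tgen _ _ => True
  | tbd _ _ t => twf t
  | tcomp k t u => [/\ twf t, twf u & teq (tbd true k t) (tbd false k u)]
  end.

Lemma twf_teq t : twf t -> teq t t.
Proof.
elim: t => [i x|a k t IH|k t IHt u IHu] /=; first by move=> _; apply: teq_gen.
  by move/IH; apply: teq_bd.
by case=> /IHt ht /IHu hu h; apply: teq_comp.
Qed.

Lemma tbd_lt a b j k t : j < k -> teq t t ->
  teq (tbd a j (tbd b k t)) (tbd a j t).
Proof. by move=> h /(teq_bd_bd a b j k); rewrite h. Qed.

Lemma tbd_ge a b j k t : k <= j -> teq t t ->
  teq (tbd a j (tbd b k t)) (tbd b k t).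
Proof. by move=> h /(teq_bd_bd a b j k); rewrite ltnNge h. Qed.

Lemma teq_compP k t u : teq t t -> teq u u ->
  teq (tbd true k t) (tbd false k u) -> teq (tcomp k t u) (tcomp k t u).
Proof. exact: teq_comp. Qed.

Lemma tbd_low a b c j k t u : j < k -> teq t t -> teq u u ->
  teq (tbd b k t) (tbd c k u) -> teq (tbd a j t) (tbd a j u).
Proof.
move=> jk ht hu h.
apply: teq_trans (tbd_lt a c jk hu).
apply: teq_trans (teq_bd a j h).
exact/teq_sym/tbd_lt.
Qed.

Lemma tbd_compl a j k t u : j < k -> teq t t -> teq u u ->
  teq (tbd true k t) (tbd false k u) ->
  teq (tbd a j (tcomp k t u)) (tbd a j t).
Proof.
move=> jk ht hu h; apply: (tbd_low a jk (teq_compP ht hu h) ht).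
exact: teq_bd_comp_src ht hu h.
Qed.

Lemma tbd_compr a j k t u : j < k -> teq t t -> teq u u ->
  teq (tbd true k t) (tbd false k u) ->
  teq (tbd a j (tcomp k t u)) (tbd a j u).
Proof.
move=> jk ht hu h; apply: teq_trans (tbd_low a jk ht hu h).
exact: tbd_compl.
Qed.

Lemma teq_bd_composable a j k t u : j != k -> teq t t -> teq u u ->
  teq (tbd true k t) (tbd false k u) ->
  teq (tbd true k (tbd a j t)) (tbd false k (tbd a j u)).
Proof.
move=> jk ht hu h; case: (ltngtP j k) => hjk; last by rewrite hjk eqxx in jk.
  apply: teq_trans (tbd_ge true a (ltnW hjk) ht) _.
  apply: teq_trans (teq_sym (tbd_ge false a (ltnW hjk) hu)).
  exact: tbd_low hjk ht hu h.
apply: teq_trans (tbd_lt true a hjk ht) _.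
exact: teq_trans h (teq_sym (tbd_lt false a hjk hu)).
Qed.

Lemma teq_twf t u : teq t u -> twf t /\ twf u.
Proof.
elim=> {t u} //=.
- by move=> t u _ [].
- by move=> t u v _ [ht _] _ [_ hv].
- move=> k t t' u u' et [ht ht'] eu [hu hu'] e _; split; split=> //.
  apply: teq_trans (teq_bd _ _ (teq_sym et)) _.
  exact: teq_trans e (teq_bd _ _ eu).
- by move=> k i x y h; split=> //; split=> //; apply: teq_trans (teq_sym (teq_gen_bd _ _ _)) _;
    apply: teq_trans (teq_gen_bd _ _ _); rewrite h; apply: teq_gen.
- by move=> a b j k t _ [h _]; case: ifP.
- move=> k t et [ht _]; split=> //; split=> //.
  exact: tbd_ge.
- move=> k t et [ht _]; split=> //; split=> //.
  exact/teq_sym/tbd_ge.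
- by move=> k t u et [ht _] eu [hu _] e _.
- by move=> k t u et [ht _] eu [hu _] e _.
- move=> a j k t u jk et [ht _] eu [hu _] e _; split=> //; split=> //.
  exact: teq_bd_composable.
- move=> k t u v et [ht _] eu [hu _] ev [hv _] e _ e' _; split; split=> //.
    exact: teq_trans (teq_bd_comp_tgt et eu e) e'.
  exact: teq_trans e (teq_sym (teq_bd_comp_src eu ev e')).
- move=> j k t u v w jk et [ht _] eu [hu _] ev [hv _] ew [hw _] e _ e' _ f _.
  have ft : teq (tbd true j t) (tbd false j v).
    apply: teq_trans (teq_sym (tbd_compl _ jk et eu e)) _.
    exact: teq_trans f (tbd_compl _ jk ev ew e').
  have fu : teq (tbd true j u) (tbd false j w).
    apply: teq_trans (teq_sym (tbd_compr _ jk et eu e)) _.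
    exact: teq_trans f (tbd_compr _ jk ev ew e').
  split; split=> //.
  have kj : k != j by rewrite neq_ltn jk orbT.
  apply: teq_trans (teq_bd_comp true kj et ev ft) _.
  apply: teq_trans (teq_sym (teq_bd_comp false kj eu ew fu)).
  apply: teq_comp => //; apply: teq_trans (tbd_lt true true jk et) _.
  exact: teq_trans ft (teq_sym (tbd_lt false true jk ev)).
Qed.

Lemma term_fin t : twf t -> exists k, teq (tbd false k t) t.
Proof.
suff H : twf t -> exists k, forall j, k <= j -> teq (tbd false j t) t.
  by move/H => [k hk]; exists k; apply: hk.
elim: t => [i x|a k t IH|k t IHt u IHu] /=.
- move=> _; have [k hk] := fin_dim x; exists k => j kj.
  apply: teq_trans (teq_sym (teq_gen_bd _ _ _)) _.
  rewrite (bd_fix _ hk kj); exact: teq_gen.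
- by move=> ht; exists k => j kj; apply: tbd_ge => //; apply: twf_teq.
- case=> wt wu e; have [kt ht] := IHt wt; have [ku hu] := IHu wu.
  exists (maxn k.+1 (maxn kt ku)) => j; rewrite !geq_max => /and3P [hk hkt hku].
  have et := twf_teq wt; have eu := twf_teq wu.
  have jk : j != k by rewrite neq_ltn hk orbT.
  apply: teq_trans (teq_bd_comp false jk et eu e) _.
  apply: teq_comp; [exact: ht | exact: hu |].
  exact: teq_bd_composable.
Qed.

Definition ccell := {P : term -> Prop | exists t, twf t /\ P = teq t}.

Definition ccls t (h : twf t) : ccell := exist _ (teq t) (ex_intro _ t (conj h erefl)).

Definition crep (q : ccell) : term := sval (cid (svalP q)).

Lemma crep_wf q : twf (crep q).
Proof. by rewrite /crep; case: cid => t []. Qed.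

Lemma crep_teq q : teq (crep q) (crep q).
Proof. exact/twf_teq/crep_wf. Qed.

Lemma svalE q : sval q = teq (crep q).
Proof. by rewrite /crep; case: cid => t []. Qed.

Lemma ccell_eq q r : teq (crep q) (crep r) -> q = r.
Proof.
move=> h; have e : sval q = sval r.
  rewrite !svalE; apply: funext => t; apply: propext.
  split; apply: teq_trans => //; exact: teq_sym.
by case: q r e {h} => P hP [P' hP'] /= e; case: _ / e hP' => hP'; congr exist.
Qed.

Lemma crep_ccls t (h : twf t) : teq (crep (ccls h)) t.
Proof. by rewrite -svalE /=; apply: twf_teq. Qed.

Definition cbd a k q : ccell := @ccls (tbd a k (crep q)) (crep_wf q).

Definition ccomp k q r : ccell :=
  match pselect (teq (tbd true k (crep q)) (tbd false k (crep r))) with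
  | left h => @ccls (tcomp k (crep q) (crep r)) (And3 (crep_wf q) (crep_wf r) h)
  | right _ => q
  end.

Lemma crep_bd a k q : teq (crep (cbd a k q)) (tbd a k (crep q)).
Proof. exact: crep_ccls. Qed.

Lemma ccomposable k q r : cbd true k q = cbd false k r <->
  teq (tbd true k (crep q)) (tbd false k (crep r)).
Proof.
split=> [h|h].
  apply: teq_trans (teq_sym (crep_bd _ _ _)) _.
  by rewrite h; apply: crep_bd.
apply: ccell_eq; apply: teq_trans (crep_bd _ _ _) _.
exact: teq_trans h (teq_sym (crep_bd _ _ _)).
Qed.

Lemma crep_comp k q r : cbd true k q = cbd false k r ->
  teq (crep (ccomp k q r)) (tcomp k (crep q) (crep r)).
Proof.
by move/ccomposable=> h; rewrite /ccomp; case: pselect => // h'; apply: crep_ccls.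
Qed.

Lemma crep_compE k q r t u : teq (crep q) t -> teq (crep r) u ->
  teq (tbd true k t) (tbd false k u) -> teq (crep (ccomp k q r)) (tcomp k t u).
Proof.
move=> ht hu h.
have h' : teq (tbd true k (crep q)) (tbd false k (crep r)).
  apply: teq_trans (teq_bd _ _ ht) _.
  exact: teq_trans h (teq_bd _ _ (teq_sym hu)).
apply: teq_trans (crep_comp (proj2 (ccomposable _ _ _) h')) _.
exact: teq_comp.
Qed.

Lemma crep_bdE a k q t : teq (crep q) t -> teq (crep (cbd a k q)) (tbd a k t).
Proof. by move=> h; apply: teq_trans (crep_bd _ _ _) _; apply: teq_bd. Qed.

Lemma ccell_eqE q r t u : teq (crep q) t -> teq (crep r) u -> teq t u -> q = r.
Proof.
by move=> hq hr h; apply: ccell_eq; apply: teq_trans hq (teq_trans h (teq_sym hr)).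
Qed.

Lemma cbd_bd a b j k q :
  cbd a j (cbd b k q) = if j < k then cbd a j q else cbd b k q.
Proof.
have := teq_bd_bd a b j k (crep_teq q).
by case: ifP => _; apply: ccell_eqE; do ?apply: crep_bdE; apply: crep_teq.
Qed.

Lemma ccomp_idl k q : ccomp k (cbd false k q) q = q.
Proof.
apply: ccell_eqE (teq_idl k (crep_teq q)); last exact: crep_teq.
apply: crep_compE; [exact: crep_bd | exact: crep_teq |].
by apply: tbd_ge => //; apply: crep_teq.
Qed.

Lemma ccomp_idr k q : ccomp k q (cbd true k q) = q.
Proof.
apply: ccell_eqE (teq_idr k (crep_teq q)); last exact: crep_teq.
apply: crep_compE; [exact: crep_teq | exact: crep_bd |].
by apply/teq_sym/tbd_ge => //; apply: crep_teq.
Qed.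

Lemma cbd_comp_src k q r : cbd true k q = cbd false k r ->
  cbd false k (ccomp k q r) = cbd false k q.
Proof.
move=> h; have /ccomposable h' := h.
apply: ccell_eqE (teq_bd_comp_src (crep_teq q) (crep_teq r) h').
  exact/crep_bdE/crep_comp.
exact: crep_bd.
Qed.

Lemma cbd_comp_tgt k q r : cbd true k q = cbd false k r ->
  cbd true k (ccomp k q r) = cbd true k r.
Proof.
move=> h; have /ccomposable h' := h.
apply: ccell_eqE (teq_bd_comp_tgt (crep_teq q) (crep_teq r) h').
  exact/crep_bdE/crep_comp.
exact: crep_bd.
Qed.

Lemma cbd_comp a j k q r : j != k -> cbd true k q = cbd false k r ->
  cbd a j (ccomp k q r) = ccomp k (cbd a j q) (cbd a j r).
Proof.
move=> jk h; have /ccomposable h' := h.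
apply: ccell_eqE (teq_bd_comp a jk (crep_teq q) (crep_teq r) h').
  exact/crep_bdE/crep_comp.
apply: crep_compE; [exact: crep_bd | exact: crep_bd |].
by apply: teq_bd_composable => //; apply: crep_teq.
Qed.

Lemma ccomp_assoc k q r s :
  cbd true k q = cbd false k r -> cbd true k r = cbd false k s ->
  ccomp k (ccomp k q r) s = ccomp k q (ccomp k r s).
Proof.
move=> /ccomposable h /ccomposable h'.
have eq := crep_teq q; have er := crep_teq r; have es := crep_teq s.
apply: ccell_eqE (teq_assoc eq er es h h').
  apply: crep_compE => //; first exact: crep_compE.
  exact: teq_trans (teq_bd_comp_tgt eq er h) h'.
apply: crep_compE => //; first exact: crep_compE.
exact: teq_trans h (teq_sym (teq_bd_comp_src er es h')).
Qed.

Lemma cinterchange j k q r s t : j < k ->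
  cbd true k q = cbd false k r -> cbd true k s = cbd false k t ->
  cbd true j (ccomp k q r) = cbd false j (ccomp k s t) ->
  ccomp j (ccomp k q r) (ccomp k s t) = ccomp k (ccomp j q s) (ccomp j r t).
Proof.
move=> jk /ccomposable h /ccomposable h' /ccomposable f.
have eq := crep_teq q; have er := crep_teq r.
have es := crep_teq s; have et := crep_teq t.
have f' : teq (tbd true j (tcomp k (crep q) (crep r)))
              (tbd false j (tcomp k (crep s) (crep t))).
  apply: teq_trans (teq_trans (teq_bd _ _ (teq_sym _)) f) (teq_bd _ _ _);
  exact: crep_compE.
have ic := teq_interchange jk eq er es et h h' f'.
have [_ [/= [_ _ fl] [_ _ fr] fk]] := teq_twf ic.
by apply: ccell_eqE ic; do ?apply: crep_compE.
Qed.

Lemma cfin_dim q : exists k, cbd false k q = q.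
Proof.
have [k hk] := term_fin (crep_wf q); exists k.
by apply: ccell_eqE hk; [exact: crep_bd | exact: crep_teq].
Qed.

Definition colim : omegaCat :=
  OmegaCat cbd_bd ccomp_idl ccomp_idr cbd_comp_src cbd_comp_tgt cbd_comp
    ccomp_assoc cinterchange cfin_dim.

Definition leg_fun i (x : dX i) : colim := @ccls (tgen x) I.

Lemma leg_bd i a k (x : dX i) : leg_fun (bd a k x) = bd a k (leg_fun x).
Proof.
apply: ccell_eqE (teq_gen_bd a k x); first exact: crep_ccls.
exact/crep_bdE/crep_ccls.
Qed.

Lemma leg_comp i k (x y : dX i) : composable k x y ->
  leg_fun (comp k x y) = comp k (leg_fun x) (leg_fun y).
Proof.
move=> h; have e := teq_gen_comp h.
apply: ccell_eqE (e); first exact: crep_ccls.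
have [_ /= [_ _ e']] := teq_twf e.
by apply: crep_compE e'; apply: crep_ccls.
Qed.

Definition leg i : functor (dX i) colim := Functor (@leg_bd i) (@leg_comp i).

Lemma leg_cocone : is_cocone leg.
Proof.
by move=> j y; apply: ccell_eqE (teq_glue y); apply: crep_ccls.
Qed.

Section Desc.
Variables (E : omegaCat) (c : forall i : dI D, functor (dX i) E).
Hypothesis hc : is_cocone c.

Fixpoint teval (t : term) : E :=
  match t with
  | tgen i x => c i x
  | tbd a k t => bd a k (teval t)
  | tcomp k t u => comp k (teval t) (teval u)
  end.

Lemma teval_teq t u : teq t u -> teval t = teval u.
Proof.
elim=> {t u} //=.
- by move=> t u v _ -> _ ->.
- by move=> a k t t' _ ->.
- by move=> k t t' u u' _ -> _ ->.
- by move=> a k i x; rewrite fmap_bd.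
- by move=> k i x y h; rewrite fmap_comp.
- by move=> a b j k t _ _; rewrite bd_bd; case: ifP.
- by move=> *; apply: comp_idl.
- by move=> *; apply: comp_idr.
- by move=> *; apply: bd_comp_src.
- by move=> *; apply: bd_comp_tgt.
- by move=> *; apply: bd_comp.
- by move=> *; apply: comp_assoc.
- by move=> *; apply: interchange.
Qed.

Definition desc_fun (q : colim) : E := teval (crep q).

Lemma desc_bd a k (q : colim) : desc_fun (bd a k q) = bd a k (desc_fun q).
Proof. exact: (teval_teq (crep_bd a k q)). Qed.

Lemma desc_comp k (q r : colim) : composable k q r ->
  desc_fun (comp k q r) = comp k (desc_fun q) (desc_fun r).
Proof. by move=> h; apply: (teval_teq (crep_comp h)). Qed.

Definition desc : functor colim E := Functor desc_bd desc_comp.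

Lemma desc_leg i (x : dX i) : desc (leg i x) = c i x.
Proof. exact: (teval_teq (crep_ccls (t := tgen x) I)). Qed.

End Desc.

Lemma colim_ext (E : omegaCat) (h h' : functor colim E) :
  (forall i, compF h (leg i) =1 compF h' (leg i)) -> h =1 h'.
Proof.
move=> hh q.
suff H t (w : twf t) : h (ccls w) = h' (ccls w).
  have -> : q = ccls (crep_wf q).
    by apply: ccell_eq; apply/teq_sym/crep_ccls.
  exact: H.
elim: t w => [i x|a k t IH|k t IHt u IHu] w.
- have -> : ccls w = leg i x by congr ccls; apply: Prop_irrelevance.
  exact: hh.
- have -> : ccls w = bd a k (ccls (w : twf t) : colim).
    apply: ccell_eqE (teq_bd a k (twf_teq (w : twf t))); first exact: crep_ccls.
    exact/crep_bdE/crep_ccls.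
  by rewrite !fmap_bd IH.
- have [wt wu e] := w.
  have ew : ccls w = comp k (ccls wt : colim) (ccls wu : colim).
    apply: ccell_eqE (twf_teq w); first exact: crep_ccls.
    by apply: crep_compE e; apply: crep_ccls.
  have cw : composable k (ccls wt : colim) (ccls wu : colim).
    apply/ccomposable; apply: teq_trans (teq_bd _ _ (crep_ccls _)) _.
    exact: teq_trans e (teq_bd _ _ (teq_sym (crep_ccls _))).
  by rewrite ew !fmap_comp // IHt IHu.
Qed.

Lemma colimP : is_colimit leg.
Proof.
split; [exact: leg_cocone | | exact: colim_ext].
by move=> E c hc; exists (desc hc) => i x; apply: desc_leg.
Qed.

End Colimit.

Inductive theta : Type := Cell n of 'I_n -> theta.

Fixpoint real (T : theta) : omegaCat :=
  let: Cell n A := T in wedge (fun i => real (A i)).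

Definition ord0_elim (P : 'I_0 -> Type) (i : 'I_0) : P i :=
  False_rect _ (notF (ltn_ord i)).

Definition theta0 : theta := @Cell 0 (ord0_elim (fun=> theta)).

(** The terminal omega-category [0]. *)
Definition point : omegaCat := real theta0.

Lemma point_eq (x y : point) : x = y.
Proof.
apply: wcell_eq; [by rewrite !ord1 | by rewrite !ord1 |].
by move=> k; exfalso; case: k.
Qed.

Definition bang (C : omegaCat) : functor C point :=
  @Functor C point (fun=> wobj _ ord0)
    (fun _ _ _ => point_eq _ _) (fun _ _ _ _ => point_eq _ _).

(** A functor [C -> D i] seen as a functor [C -> D j] when [j = i]. *)
Definition castF (C : omegaCat) (I : Type) (D : I -> omegaCat) (i j : I)
    (e : j = i) (F : functor C (D i)) : functor C (D j) :=
  match esym e in _ = j' return functor C (D j') with erefl => F end.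

(** The functors [f;(g)] for [f] an interval inclusion: [h] is the action of
    [f] on components, so that [Hom(i,i+1)] is sent to the single component
    [h i] by [g i]. *)
Section Emb.
Variables (n m : nat) (C : 'I_n -> omegaCat) (D : 'I_m -> omegaCat).
Variables (f : 'I_n.+1 -> 'I_m.+1) (h : 'I_n -> 'I_m) (p : nat).
Hypothesis fE : forall i, f i = p + i :> nat.
Hypothesis hE : forall i, h i = p + i :> nat.
Variable g : forall i, functor (C i) (D (h i)).

Lemma emb_mono (i j : 'I_n.+1) : i <= j -> f i <= f j.
Proof. by rewrite !fE; lia. Qed.

Lemma emb_idx (i : 'I_n) (j : 'I_m) : f (lo i) <= j < f (hi i) -> j = h i.
Proof. by rewrite !fE hiE loE => H; apply: ord_inj; rewrite hE; lia. Qed.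

Definition wedge_emb : functor (wedge C) (wedge D) :=
  wedge_map emb_mono (fun i j H => castF (emb_idx H) (g i)).

Lemma emb_over (i : 'I_n) : f (lo i) <= h i < f (hi i).
Proof. by rewrite !fE hE hiE loE; lia. Qed.

Lemma emb_val (X : wcell C) (i : 'I_n) H (hX : wsrc X <= i < wtgt X) :
  @wval _ _ (wedge_emb X) (h i) H = g i (wval hX).
Proof.
have -> : wval H = castF (emb_idx (emb_over i)) (g i) (wval hX).
  exact: wmap_val.
by rewrite (Prop_irrelevance (emb_idx _) erefl).
Qed.

End Emb.

(** The functor [id;(g)]. *)
Definition wedge_id n (C D : 'I_n -> omegaCat) (g : forall i, functor (C i) (D i)) :
    functor (wedge C) (wedge D) :=
  @wedge_emb n n C D id id 0 (fun=> erefl) (fun=> erefl) g.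

Lemma wedge_id_val n (C D : 'I_n -> omegaCat) (g : forall i, functor (C i) (D i))
    (X : wcell C) (i : 'I_n) h (hX : wsrc X <= i < wtgt X) :
  @wval _ _ (wedge_id g X) i h = g i (wval hX).
Proof. exact: (@emb_val n n C D id id 0 (fun=> erefl) (fun=> erefl) g). Qed.

(** The translation [i |-> p + i]. *)
Lemma shift_lt p n m (i : 'I_n) : p + n <= m -> p + i < m.
Proof. by have := ltn_ord i; lia. Qed.

Definition shift p n m (H : p + n <= m) (i : 'I_n) : 'I_m :=
  Ordinal (shift_lt i H).

Lemma shiftS p n m : p + n <= m -> p + n.+1 <= m.+1.
Proof. by rewrite addnS. Qed.

(** A cylinder on [T] comes with its end inclusions: [cyl_in false] is
    {0} (x) T and [cyl_in true] is {1} (x) T. *)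
Record cylData (T : omegaCat) := CylData {
  cyl_cat :> omegaCat;
  cyl_in : bool -> functor T cyl_cat
}.

Section Cylinder.
Variables (n : nat) (C : 'I_n -> omegaCat) (K : forall i, cylData (C i)).

Definition optfam (o : option 'I_n) : omegaCat :=
  if o is Some i then C i else point.

(** [Pcat q] is [n+1];(C_1,...,[0],...,C_n), with [0] in position [q]. *)
Definition Pcat (q : 'I_n.+1) : omegaCat :=
  wedge (fun j : 'I_n.+1 => optfam (unlift q j)).

Definition qfam (b : bool) (i : 'I_n) : omegaCat :=
  if b then cyl_cat (K i) else C i.

Definition Qcat (k : 'I_n) : omegaCat := wedge (fun i => qfam (i == k) i).

Definition optF (o : option 'I_n) (i : 'I_n) :
    (forall i', o = Some i' -> i' = i) -> functor (C i) (optfam o) :=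
  match o with
  | Some i' => fun H => castF (H i' erefl) (idF (C i))
  | None => fun=> bang (C i)
  end.

(** The object omitted by [face q b]: [q] if [b], else [q+1]. *)
Definition omit (q : 'I_n.+1) (b : bool) : 'I_n.+2 := if b then lo q else hi q.

Lemma lift_mono (r : 'I_n.+2) (i j : 'I_n.+1) :
  i <= j -> lift r i <= lift r j.
Proof. by rewrite /= leq_bump2. Qed.

Lemma face_idx (q : 'I_n.+1) (b : bool) (i : 'I_n) (j : 'I_n.+1) :
  lift (omit q b) (lo i) <= j < lift (omit q b) (hi i) ->
  forall i', unlift q j = Some i' -> i' = i.
Proof.
move=> H i' e; apply: ord_inj; case: unliftP e H => // _ -> [->].
rewrite /omit; case: b; rewrite /= ?loE ?hiE /bump /=; lia.
Qed.

(** The functors [d^r;(...)] from [n];(C_1,...,C_n) to [Pcat q], for [r = q] and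
    [r = q+1].  Each component is an identity, except that [C_q] is sent by
    [(id,!)] if [r = q] and [0 < q], and [C_(q+1)] by [(!,id)] if [r = q+1] and
    [q < n] (with components numbered from 1). *)
Definition face (q : 'I_n.+1) (b : bool) : functor (wedge C) (Pcat q) :=
  wedge_map (@lift_mono (omit q b)) (fun i j H => optF (face_idx H)).

(** The functor [id;(id,...,{e} (x) C_k,...,id)]. *)
Definition qin (k : 'I_n) (e : bool) : functor (wedge C) (Qcat k) :=
  wedge_id (fun i =>
    if i == k as b return functor (C i) (qfam b i)
    then cyl_in (K i) e else idF (C i)).

(** The zigzag [P_0 <- T -> Q_1 <- T -> P_1 <- ... -> P_n], as a diagram of
    spans: [inl q] stands for [P_q] (0 <= q <= n) and [inr k] for [Q_(k+1)]; the
    span [(k, true)] joins [P_k] to [Q_(k+1)], and [(k, false)] joins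
    [P_(k+1)] to [Q_(k+1)]. *)
Definition cyl_diag : spanDiagram :=
  @SpanDiagram ('I_n.+1 + 'I_n)%type ('I_n * bool)%type
    (fun v => match v with inl q => Pcat q | inr k => Qcat k end)
    (fun=> wedge C)
    (fun j => inl (if j.2 then lo j.1 else hi j.1))
    (fun j => inr j.1)
    (fun j => face (if j.2 then lo j.1 else hi j.1) (~~ j.2))
    (fun j => qin j.1 j.2).

Definition cyl_P (q : 'I_n.+1) : functor (Pcat q) (colim cyl_diag) :=
  @leg cyl_diag (inl q).
Definition cyl_Q (k : 'I_n) : functor (Qcat k) (colim cyl_diag) :=
  @leg cyl_diag (inr k).

Definition cyl_step : cylData (wedge C) :=
  CylData (fun e : bool => if e then compF (cyl_P ord0) (face ord0 true)
                           else compF (cyl_P ord_max) (face ord_max false)).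

End Cylinder.

(** [cyl T] is the lax shuffle cylinder [1] (x) T with its two ends. *)
Fixpoint cyl (T : theta) : cylData (real T) :=
  match T return cylData (real T) with
  | Cell n A => cyl_step (fun i => cyl (A i))
  end.

Fixpoint incl (S T : theta) {struct S} : Type :=
  let: Cell n A := S in let: Cell m B := T in
  {p : nat & {H : p + n <= m & forall i, incl (A i) (B (shift H i))}}.

Section InclStep.
Variables (n m p : nat) (H : p + n <= m).
Variables (C : 'I_n -> omegaCat) (D : 'I_m -> omegaCat).
Variables (g : forall i, functor (C i) (D (shift H i))).

Definition incl_step : functor (wedge C) (wedge D) :=
  @wedge_emb n m C D (shift (shiftS H)) (shift H) p
    (fun=> erefl) (fun=> erefl) g.

End InclStep.

Fixpoint real_incl (S T : theta) {struct S} : incl S T -> functor (real S) (real T) :=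
  match S, T return incl S T -> functor (real S) (real T) with
  | Cell n A, Cell m B => fun u =>
      let: existT p (existT H g) := u in
      incl_step (fun i => real_incl (g i))
  end.

Section CylinderTheory.
Variables (n : nat) (C : 'I_n -> omegaCat) (K : forall i, cylData (C i)).
Implicit Types X : wcell C.

Definition cyl_face (q : 'I_n.+1) (b : bool) :
    functor (wedge C) (colim (cyl_diag K)) := compF (cyl_P K q) (face C q b).
Arguments cyl_face : simpl never.

Lemma cyl_glue (k : 'I_n) (b : bool) X :
  cyl_face (if b then lo k else hi k) (~~ b) X = cyl_Q K k (qin K k b X).
Proof. exact: (@leg_cocone (cyl_diag K) (k, b) X). Qed.

Lemma optF_irr o i (h h' : forall i', o = Some i' -> i' = i) :
  optF C h = optF C h'.
Proof. by congr optF; apply: Prop_irrelevance. Qed.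

Lemma face_eq (q : 'I_n.+1) X : q < wsrc X \/ wtgt X < q ->
  face C q true X = face C q false X.
Proof.
move=> hq; have hle := wle X.
have obj (x : 'I_n.+1) : wsrc X <= x <= wtgt X ->
    lift (omit q true) x = lift (omit q false) x.
  move=> hx; apply: ord_inj; rewrite /= /bump /= ?hiE ?loE; lia.
have es := obj (wsrc X); have et := obj (wtgt X).
apply: wcell_eq; [by apply: es; lia | by apply: et; lia |].
move=> j h h'.
have [i [hi' hX]] := wmap_dom (@lift_mono n (omit q true)) h.
have hi'' : lift (omit q false) (lo i) <= j < lift (omit q false) (hi i).
  by rewrite -!obj // ?hiE ?loE; lia.
have -> : wval h = optF C (face_idx hi') (wval hX) by exact: wmap_val.
have -> : wval h' = optF C (face_idx hi'') (wval hX) by exact: wmap_val.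
by rewrite (optF_irr _ (face_idx hi'')).
Qed.

Lemma qin_eq (k : 'I_n) X : ~~ (wsrc X <= k < wtgt X) ->
  qin K k true X = qin K k false X.
Proof.
move=> hk; apply: wcell_eq => // i h h'.
have hX : wsrc X <= i < wtgt X by [].
rewrite (wedge_id_val h hX) (wedge_id_val h' hX).
by move: hk; case: eqP => // <-; rewrite hX.
Qed.

Lemma cyl_face_eq (q : 'I_n.+1) X : q < wsrc X \/ wtgt X < q ->
  cyl_face q true X = cyl_face q false X.
Proof. by move=> h; apply: (congr1 (cyl_P K q) (face_eq h)). Qed.

Lemma cyl_face_next (k : 'I_n) X : ~~ (wsrc X <= k < wtgt X) ->
  cyl_face (lo k) false X = cyl_face (hi k) true X.
Proof.
by move=> h; rewrite (cyl_glue k true) (cyl_glue k false) qin_eq.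
Qed.

Lemma cyl_face_true (a : 'I_n.+1) X : a <= wsrc X ->
  cyl_face ord0 true X = cyl_face a true X.
Proof.
case: a => a; elim: a => [|a IH] ha hX.
  by have -> : Ordinal ha = ord0 by apply: ord_inj.
have ha' : a < n by [].
have e1 : Ordinal (ltnW ha) = lo (Ordinal ha') by apply: ord_inj.
have e2 : Ordinal ha = hi (Ordinal ha') by apply: ord_inj; rewrite hiE.
have ha1 : a < wsrc X by [].
rewrite (IH (ltnW ha) (ltnW ha1)) cyl_face_eq; last by left.
by rewrite e1 e2; apply: cyl_face_next; rewrite /=; lia.
Qed.

Lemma cyl_face_false (a : 'I_n.+1) X : wtgt X <= a ->
  cyl_face ord_max false X = cyl_face a false X.
Proof.
move: {2}(n - a) (erefl (n - a)) => d; elim: d a => [|d IH] a hd ha.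
  have -> // : a = ord_max by apply: ord_inj => /=; have := ltn_ord a; lia.
have ha' : a < n by lia.
have -> : a = lo (Ordinal ha') by apply: ord_inj.
rewrite cyl_face_next; last by rewrite /=; lia.
rewrite cyl_face_eq; last by rewrite hiE /=; lia.
by apply: IH; rewrite hiE /=; lia.
Qed.

End CylinderTheory.

Section CylMap.
Variables (n m p : nat) (H : p + n <= m).
Variables (C : 'I_n -> omegaCat) (D : 'I_m -> omegaCat).
Variables (K : forall i, cylData (C i)) (L : forall j, cylData (D j)).
Variable g : forall i, functor (C i) (D (shift H i)).
Variable G : forall i, functor (K i) (L (shift H i)).
Hypothesis Gg : forall i e x, G i (cyl_in (K i) e x) = cyl_in (L _) e (g i x).

Local Notation sh := (shift (shiftS H)).

Lemma unlift_shift (q j : 'I_n.+1) :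
  unlift (sh q) (sh j) = omap (shift H) (unlift q j).
Proof.
case: (unliftP q j) => [i ->|->] /=; last by rewrite unlift_none.
have -> : sh (lift q i) = lift (sh q) (shift H i).
  by apply: ord_inj; rewrite /= /bump; lia.
by rewrite liftK.
Qed.

Lemma shift_eq (i k : 'I_n) : (shift H i == shift H k) = (i == k).
Proof. by rewrite -!val_eqE /= eqn_add2l. Qed.

Definition optmap (o : option 'I_n) :
    functor (optfam C o) (optfam D (omap (shift H) o)) :=
  match o with Some i => g i | None => idF point end.

Definition qmap (b : bool) (i : 'I_n) :
    functor (qfam K b i) (qfam L b (shift H i)) :=
  if b as b return functor (qfam K b i) (qfam L b (shift H i))
  then G i else g i.

(** The map [P_q -> P_(p+q)]. *)
Definition shiftP (q : 'I_n.+1) : functor (Pcat C q) (Pcat D (sh q)) :=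
  @incl_step n.+1 m.+1 p (shiftS H)
    (fun j => optfam C (unlift q j)) (fun j => optfam D (unlift (sh q) j))
    (fun j => castF (unlift_shift q j) (optmap (unlift q j))).

(** The map [Q_k -> Q_(p+k)]. *)
Definition shiftQ (k : 'I_n) : functor (Qcat K k) (Qcat L (shift H k)) :=
  @incl_step n m p H
    (fun i => qfam K (i == k) i) (fun j => qfam L (j == shift H k) j)
    (fun i => castF (D := fun b => qfam L b (shift H i)) (shift_eq i k)
                (qmap (i == k) i)).

Lemma optmap_optF o o' i (e : o' = omap (shift H) o)
    (h : forall i', o = Some i' -> i' = i)
    (h' : forall i', o' = Some i' -> i' = shift H i) (x : C i) :
  castF e (optmap o) (optF C h x) = optF D h' (g i x).
Proof.
subst o'; rewrite /castF /=.
case: o h h' => [i'|] h h' /=; last exact: point_eq.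
have ei := h i' erefl; subst i'.
by rewrite (Prop_irrelevance (h _ _) erefl) (Prop_irrelevance (h' _ _) erefl).
Qed.

Lemma incl_step_val (X : wcell C) (i : 'I_n) h (hX : wsrc X <= i < wtgt X) :
  @wval _ _ (incl_step g X) (shift H i) h = g i (wval hX).
Proof.
exact: (@emb_val n m C D (shift (shiftS H)) (shift H) p
          (fun=> erefl) (fun=> erefl) g).
Qed.

Lemma shift_omit q b :
  shift (shiftS (shiftS H)) (omit q b) = omit (sh q) b.
Proof. by apply: ord_inj; rewrite /omit; case: b; rewrite ?loE ?hiE /= ?addnS. Qed.

Lemma shift_lift (r : 'I_n.+2) (x : 'I_n.+1) :
  shift (shiftS (shiftS H)) (lift r x) =
  lift (shift (shiftS (shiftS H)) r) (sh x).
Proof. by apply: ord_inj; rewrite /= /bump; lia. Qed.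

Lemma shiftP_face q b (X : wcell C) :
  shiftP q (face C q b X) = face D (sh q) b (incl_step g X).
Proof.
have E x : shift (shiftS (shiftS H)) (lift (omit q b) x)
           = lift (omit (sh q) b) (sh x) by rewrite shift_lift shift_omit.
apply: wcell_eq; [exact: E | exact: E |].
move=> j h h'.
have hj : p <= j < p + n.+1.
  have := ltn_ord (wtgt (face C q b X)).
  by move: h; rewrite /=; lia.
have hj' : j - p < n.+1 by lia.
have ej : j = sh (Ordinal hj') by apply: ord_inj; rewrite /=; lia.
move: h h'; rewrite {}ej; move: (Ordinal hj') => {hj hj'} {}j h h'.
have hF : wsrc (face C q b X) <= j < wtgt (face C q b X).
  by move: h; rewrite /=; lia.
have [i [hi' hX]] := wmap_dom (@lift_mono n (omit q b)) hF.
have hi'' : lift (omit (sh q) b) (lo (shift H i)) <= sh j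
            < lift (omit (sh q) b) (hi (shift H i)).
  have -> : lo (shift H i) = sh (lo i) by apply: ord_inj.
  have -> : hi (shift H i) = sh (hi i).
    by apply: ord_inj; rewrite /= /bump; lia.
  by rewrite -!E; move: hi'; rewrite /=; lia.
have hX' : wsrc (incl_step g X) <= shift H i < wtgt (incl_step g X).
  by move: hX; rewrite /=; lia.
have -> : wval h = castF (unlift_shift q j) (optmap (unlift q j)) (wval hF).
  exact: (@emb_val n.+1 m.+1 _ _ (shift (shiftS (shiftS H))) sh p
            (fun=> erefl) (fun=> erefl)).
have -> : wval hF = optF C (face_idx hi') (wval hX) by exact: wmap_val.
have -> : wval h' = optF D (face_idx hi'') (wval hX') by exact: wmap_val.
by rewrite (incl_step_val hX' hX); apply: optmap_optF.
Qed.

Lemma qmap_in b b' (e : b' = b) i a (x : C i) :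
  castF (D := fun b => qfam L b (shift H i)) e (qmap b i)
    ((if b as b return functor (C i) (qfam K b i)
      then cyl_in (K i) a else idF (C i)) x) =
  (if b' as b return functor (D (shift H i)) (qfam L b (shift H i))
   then cyl_in (L (shift H i)) a else idF (D (shift H i))) (g i x).
Proof. by subst b'; case: b => //=; apply: Gg. Qed.

Lemma shiftQ_in k b (X : wcell C) :
  shiftQ k (qin K k b X) = qin L (shift H k) b (incl_step g X).
Proof.
apply: wcell_eq => // j h h'.
have hj : p <= j < p + n.
  have := ltn_ord (wtgt X).
  by move: h; rewrite /=; lia.
have hj' : j - p < n by lia.
have ej : j = shift H (Ordinal hj') by apply: ord_inj; rewrite /=; lia.
move: h h'; rewrite {}ej; move: (Ordinal hj') => {hj hj'} {}j h h'.
have hX : wsrc X <= j < wtgt X by move: h; rewrite /=; lia.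
have hX' : wsrc (incl_step g X) <= shift H j < wtgt (incl_step g X).
  by move: hX; rewrite /=; lia.
have hF : wsrc (qin K k b X) <= j < wtgt (qin K k b X) by [].
have -> : wval h = castF (D := fun b => qfam L b (shift H j)) (shift_eq j k)
                     (qmap (j == k) j) (wval hF).
  exact: (@emb_val n m (fun i => qfam K (i == k) i)
            (fun j => qfam L (j == shift H k) j) sh (shift H) p
            (fun=> erefl) (fun=> erefl)
            (fun i => castF (D := fun b => qfam L b (shift H i)) (shift_eq i k)
                        (qmap (i == k) i))).
rewrite (wedge_id_val hF hX) (wedge_id_val h' hX') (incl_step_val hX' hX).
exact: qmap_in.
Qed.

Definition cyl_map_legs (v : 'I_n.+1 + 'I_n) :
    functor (@dX (cyl_diag K) v) (colim (cyl_diag L)) :=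
  match v with
  | inl q => compF (cyl_P L (sh q)) (shiftP q)
  | inr k => compF (cyl_Q L (shift H k)) (shiftQ k)
  end.

Lemma cyl_map_cocone : @is_cocone (cyl_diag K) _ cyl_map_legs.
Proof.
case=> k b X.
change (cyl_P L (sh (if b then lo k else hi k))
          (shiftP _ (face C (if b then lo k else hi k) (~~ b) X)) =
        cyl_Q L (shift H k) (shiftQ k (qin K k b X))).
rewrite shiftP_face shiftQ_in -cyl_glue.
have -> // : sh (if b then lo k else hi k)
           = if b then lo (shift H k) else hi (shift H k).
by apply: ord_inj; case: (b); rewrite /= /bump; lia.
Qed.

(** The functor induced by the maps [P_q -> P_(p+q)] and [Q_k -> Q_(p+k)]. *)
Definition cyl_map : functor (cyl_step K) (cyl_step L) := desc cyl_map_cocone.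

Lemma cyl_map_in e (X : wcell C) :
  cyl_map (cyl_in (cyl_step K) e X) = cyl_in (cyl_step L) e (incl_step g X).
Proof.
have hdesc q b : cyl_map (cyl_face K q b X) = cyl_face L (sh q) b (incl_step g X).
  rewrite /cyl_map; have -> := @desc_leg _ _ _ cyl_map_cocone (inl q) (face C q b X).
  exact: (congr1 (cyl_P L (sh q)) (shiftP_face q b X)).
case: e.
  have -> := hdesc ord0 true; apply/esym/cyl_face_true.
  by rewrite /=; lia.
have -> := hdesc ord_max false; apply/esym/cyl_face_false.
by rewrite /=; have := ltn_ord (wtgt X); lia.
Qed.

End CylMap.

(** The functor [1] (x) u, together with its compatibility with the two ends,
    which is needed to define it recursively. *)
Fixpoint cyl_incl_sig (S T : theta) {struct S} : forall u : incl S T,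
    {F : functor (cyl S) (cyl T) |
      forall e x, F (cyl_in (cyl S) e x) = cyl_in (cyl T) e (real_incl u x)} :=
  match S, T return forall u : incl S T,
    {F : functor (cyl S) (cyl T) |
      forall e x, F (cyl_in (cyl S) e x) = cyl_in (cyl T) e (real_incl u x)}
  with
  | Cell n A, Cell m B => fun u =>
      let: existT p (existT H g) := u in
      let G i := cyl_incl_sig (g i) in
      exist _ (cyl_map (fun i => svalP (G i))) (cyl_map_in (fun i => svalP (G i)))
  end.

Definition cyl_incl (S T : theta) (u : incl S T) : functor (cyl S) (cyl T) :=
  sval (cyl_incl_sig u).

Fixpoint globe (n : nat) : theta :=
  if n is n'.+1 then @Cell 1 (fun=> globe n') else theta0.

(** The globular inclusion of [0] as an object of [m];(B_1,...,B_m). *)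
Definition incl_obj m (B : 'I_m -> theta) (p : nat) (H : p + 0 <= m) :
    incl theta0 (Cell B) :=
  existT _ p (existT _ H (ord0_elim (fun i =>
    incl (ord0_elim (fun=> theta) i) (B (shift H i))))).

Lemma bool_le1 (b : bool) : b + 0 <= 1.
Proof. by case: b. Qed.

(** The iterated source ([b = false]) and target ([b = true]) inclusions of
    globes.  For [m = n] this is [1];(...;[1];(id)), that is, the identity. *)
Fixpoint globe_incl (b : bool) (m n : nat) {struct m} :
    m <= n -> incl (globe m) (globe n) :=
  match m, n return m <= n -> incl (globe m) (globe n) with
  | 0, 0 => fun=> @incl_obj 0 (ord0_elim (fun=> theta)) 0 (leqnn 0)
  | 0, n'.+1 => fun=>
      @incl_obj 1 (fun=> globe n') b (bool_le1 b)
  | m'.+1, 0 => fun h => False_rect _ (notF h)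
  | m'.+1, n'.+1 => fun h =>
      existT _ 0 (existT _ (leqnn 1) (fun=> @globe_incl b m' n' h))
  end.

Section GlobularSum.
Variables (l : nat) (n : 'I_l.+1 -> nat) (m : 'I_l -> nat).
Hypothesis hl : forall i : 'I_l, m i <= n (lo i).
Hypothesis hr : forall i : 'I_l, m i <= n (hi i).

(** The zigzag of globes, with legs [t] to the left and [s] to the right; [m i]
    is the dimension of the globe between those of index [i] and [i+1]. *)
Definition gsum_diag : spanDiagram :=
  @SpanDiagram 'I_l.+1 'I_l
    (fun i => real (globe (n i))) (fun i => real (globe (m i)))
    (@lo l) (@hi l)
    (fun i => real_incl (globe_incl true (hl i)))
    (fun i => real_incl (globe_incl false (hr i))).

(** Its image under [1] (x) -. *)
Definition cyl_gsum_diag : spanDiagram :=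
  @SpanDiagram 'I_l.+1 'I_l
    (fun i => cyl (globe (n i))) (fun i => cyl (globe (m i)))
    (@lo l) (@hi l)
    (fun i => cyl_incl (globe_incl true (hl i)))
    (fun i => cyl_incl (globe_incl false (hr i))).

(** The cell [T], with the globular inclusions [iota i], is the globular sum of
    the zigzag. *)
Definition is_globular_sum (T : theta)
    (iota : forall i : 'I_l.+1, incl (globe (n i)) T) : Prop :=
  @is_colimit gsum_diag (real T) (fun i => real_incl (iota i)).

(** [phi] is the comparison map: by [colimP], it is the only functor with this
    property. *)
Definition is_comparison (T : theta)
    (iota : forall i : 'I_l.+1, incl (globe (n i)) T)
    (phi : functor (colim cyl_gsum_diag) (cyl T)) : Prop :=
  forall i : 'I_l.+1, compF phi (@leg cyl_gsum_diag i) =1 cyl_incl (iota i).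

End GlobularSum.

(* Main.v *)
(** A functor out of the cylinder on [T = [n];(A_1,...,A_n)] amounts to two
    functors [h false], [h true] out of [T], a 1-cell [f q] from [h false q] to
    [h true q] for each object [q], and for each [k] a functor from the cylinder
    on [A_k] to the hom omega-category from [h false (k-1)] to [h true k], whose
    restrictions to the two ends are [h false] and [h true] whiskered by
    [f k] and [f (k-1)].  Hence the cylinder preserves every colimit, of
    arbitrary shape, of cells along globular inclusions whose vertex is again a
    cell.  By induction on [T]: if [T] is the colimit of the [S_i], the universal
    property of [T] yields [h false], [h true] and, tested against codiscrete
    omega-categories, [f]; tested against suspensions, it shows that [A_k] is the
    colimit of those components of the [S_i] that lie over [k], to which the
    induction hypothesis applies. *)

From mathcomp Require Import all_boot.
From mathcomp Require Import boolp.
From mathcomp Require Import zify.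
Require Import Defs.

Set Implicit Arguments.
Unset Strict Implicit.
Unset Printing Implicit Defensive.

(** * Functors out of [n];(C_1,...,C_n) *)

(** All that is known of [T] is the universal property of its cocone: neither the shape of [T] nor
    the places of the inclusions are ever computed. Whatever is needed about its vertices and
    components is read off from functors out of [T] into targets chosen for the purpose. Arbitrary
    diagram shapes spare the induction some bookkeeping: the components over [k] are indexed by
    pairs of an index [i] and a position in [S_i], and that these form a zigzag again would have to
    be shown. The other obstacle is that the data of a functor out of a cylinder are heterogeneous:
    functors, a function on vertices, and functors into homs that vary with [k]. An equation between
    such data can be checked on the [S_i] only if it equates two maps out of the vertices of [T],
    two functors out of [T], or two functors out of [A_k] or its cylinder. Every compatibility is
    brought to such a form; in particular, whiskering by a 1-cell is made into a functor. *)

Section WedgeCells.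
Variables (n : nat) (C : 'I_n -> omegaCat).
Implicit Types X Y : wcell C.

Lemma lo_le_hi (k : 'I_n) : lo k <= hi k.
Proof. by rewrite hiE loE. Qed.

Lemma wone_idx (k i : 'I_n) : lo k <= i < hi k -> k = i.
Proof. by rewrite hiE loE => h; apply: ord_inj; lia. Qed.

(** The cell of [Hom(k,k+1) = C k] given by [x]. *)
Definition wone (k : 'I_n) (x : C k) : wedge C :=
  WCell (lo_le_hi k) (fun i h => eq_rect k C x i (wone_idx h)).

Lemma wone_val k (x : C k) h : @wval _ _ (wone x) k h = x.
Proof. by rewrite /= (Prop_irrelevance (wone_idx _) erefl). Qed.

Lemma wone_dom (k : 'I_n) : lo k <= k < hi k.
Proof. by rewrite hiE loE; lia. Qed.

Lemma wone_inj k : injective (@wone k).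
Proof.
move=> x y e; have := @wval_eq _ _ _ _ e k (wone_dom k) (wone_dom k).
by rewrite !wone_val.
Qed.

Lemma woneP X k (hs : wsrc X = lo k) (ht : wtgt X = hi k) h :
  X = wone (@wval _ _ X k h).
Proof.
apply: wcell_eq => // i h1 h2.
by have e := wone_idx h2; subst i; rewrite wone_val; apply: wval_irr.
Qed.

Lemma wone_bd k a d (x : C k) : wone (bd a d x) = bd a d.+1 (wone x).
Proof.
apply: wcell_eq => // i h h'; have e := wone_idx h; subst i.
by rewrite wone_val /= (Prop_irrelevance (wone_idx _) erefl).
Qed.

Lemma wone_comp k d (x y : C k) :
  wone (comp d x y) = comp d.+1 (wone x) (wone y).
Proof.
apply: wcell_eq => // i h h'; have e := wone_idx h; subst i.
by rewrite wone_val (@wcompS_val _ _ d (wone x) (wone y) k h' h h) !wone_val.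
Qed.

Lemma wone_src k (x : C k) : bd false 0 (wone x) = wobj C (lo k).
Proof. by []. Qed.

Lemma wone_tgt k (x : C k) : bd true 0 (wone x) = wobj C (hi k).
Proof. by []. Qed.

(** The last entry of a tuple splits off as a one-component cell, whence an induction on the length
    of the interval from [wsrc X] to [wtgt X]. So a wedge is generated under composition along
    objects by its objects and the cells between consecutive objects. *)
Lemma wedge_ind (P : wedge C -> Prop) :
  (forall i, P (wobj C i)) -> (forall k (x : C k), P (wone x)) ->
  (forall X Y : wedge C, composable 0 X Y -> P X -> P Y -> P (comp 0 X Y)) ->
  forall X, P X.
Proof.
move=> Po P1 Pc X; move: {2}(wtgt X - wsrc X) (erefl (wtgt X - wsrc X)) => d.
elim: d X => [|d IH] X e; have hX := wle X.
  have est : wsrc X = wtgt X by apply: ord_inj; lia.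
  have -> : X = wobj C (wsrc X); last exact: Po.
  by apply: wcell_eq => //= k h; exfalso; lia.
have hk : (wtgt X).-1 < n by have := ltn_ord (wtgt X); lia.
pose k := Ordinal hk.
have le1 : wsrc X <= lo k by rewrite loE /=; lia.
have ht : wtgt X = hi k by apply: ord_inj; rewrite hiE /=; lia.
have dom i : wsrc X <= i < lo k -> wsrc X <= i < wtgt X.
  by rewrite ht loE hiE; lia.
have domk : wsrc X <= k < wtgt X by rewrite ht hiE /=; lia.
pose X' : wedge C := WCell le1 (fun i h => wval (dom i h)).
have c : wtgt X' = wsrc (wone (wval domk)) by [].
have -> : X = comp 0 X' (wone (wval domk)).
  rewrite [RHS](wcomp0E c); apply: wcell_eq => // i h1 h2.
  case: (wcomp0_case c h2) => [h|h].
    by rewrite (@wcomp0_vall _ _ _ _ c _ h2 h); apply: wval_irr.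
  rewrite (@wcomp0_valr _ _ _ _ c _ h2 h).
  have ei := wone_idx h; subst i.
  by rewrite wone_val; apply: wval_irr.
apply: Pc.
- by apply: wcell_eq => //= i h; exfalso; lia.
- by apply: IH; rewrite loE /=; lia.
- exact: P1.
Qed.

Lemma wedge_ext (E : omegaCat) (F G : functor (wedge C) E) :
  (forall i, F (wobj C i) = G (wobj C i)) ->
  (forall k (x : C k), F (wone x) = G (wone x)) -> F =1 G.
Proof.
move=> Ho H1; apply: wedge_ind => // X Y c HX HY.
by rewrite !fmap_comp // HX HY.
Qed.

End WedgeCells.

Arguments wone_val {n C k} x h.

Section WedgeDesc.
Variables (n : nat) (C : 'I_n -> omegaCat) (E : omegaCat).
Variables (o : 'I_n.+1 -> E) (s : forall k, C k -> E).
Hypothesis obd : forall i a, bd a 0 (o i) = o i.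
Hypothesis s_src : forall k (x : C k), bd false 0 (s x) = o (lo k).
Hypothesis s_tgt : forall k (x : C k), bd true 0 (s x) = o (hi k).
Hypothesis s_bd : forall k a d (x : C k), s (bd a d x) = bd a d.+1 (s x).
Hypothesis s_comp : forall k d (x y : C k), composable d x y ->
  s (comp d x y) = comp d.+1 (s x) (s y).
Implicit Types X Y : wedge C.

(** The object at which the partial composite of the first [j] factors of [X] ends. *)
Definition clamp X (j : nat) : 'I_n.+1 :=
  inord (minn (maxn (wsrc X) j) (wtgt X)).

Lemma clampE X j : clamp X j = minn (maxn (wsrc X) j) (wtgt X) :> nat.
Proof. by rewrite inordK //; have := ltn_ord (wtgt X); lia. Qed.

(** The [k]-th factor of the image of [X]; outside the range of [X] it is the
    identity on an end of [X]. *)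
Definition factor X (k : 'I_n) : E :=
  match @idP (wsrc X <= k < wtgt X) with
  | ReflectT p => s (wval p)
  | ReflectF _ => o (clamp X k)
  end.

Lemma factor_in X k h : factor X k = s (@wval _ _ X k h).
Proof.
rewrite /factor; case: {-}_ / idP => // p.
by rewrite (wval_irr p h).
Qed.

Lemma factor_out X (k : 'I_n) : ~~ (wsrc X <= k < wtgt X) ->
  factor X k = o (clamp X k).
Proof. by rewrite /factor; case: {-}_ / idP => // p; rewrite p. Qed.

Lemma factor_src X k : bd false 0 (factor X k) = o (clamp X k).
Proof.
case: (boolP (wsrc X <= k < wtgt X)) => h; last by rewrite factor_out.
rewrite (factor_in h) s_src; congr o; apply: ord_inj.
by rewrite clampE loE; lia.
Qed.

Lemma factor_tgt X k : bd true 0 (factor X k) = o (clamp X k.+1).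
Proof.
have hX := wle X; case: (boolP (wsrc X <= k < wtgt X)) => h.
  rewrite (factor_in h) s_tgt; congr o; apply: ord_inj.
  by rewrite clampE hiE; lia.
by rewrite factor_out // obd; congr o; apply: ord_inj; rewrite !clampE; lia.
Qed.

Lemma o_fix i a d : bd a d (o i) = o i.
Proof. exact: (bd_fix _ (obd i a)). Qed.

Lemma o_comp i d : comp d (o i) (o i) = o i.
Proof. by rewrite -{1}(o_fix i false d) comp_idl. Qed.

Lemma factor_bd a d X k : factor (bd a d.+1 X) k = bd a d.+1 (factor X k).
Proof.
case: (boolP (wsrc X <= k < wtgt X)) => h.
  by rewrite (factor_in h) (factor_in (X := bd a d.+1 X) h) -s_bd.
by rewrite !factor_out // o_fix.
Qed.

Lemma factor_comp d X Y k : composable d.+1 X Y ->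
  factor (comp d.+1 X Y) k = comp d.+1 (factor X k) (factor Y k).
Proof.
case/composableS => es et ev.
case: (boolP (wsrc X <= k < wtgt X)) => h.
  have h' : wsrc Y <= k < wtgt Y by rewrite -es -et.
  rewrite (factor_in h) (factor_in h') (factor_in (X := comp d.+1 X Y) h).
  by rewrite (@wcompS_val _ _ d X Y k h h h') s_comp //; apply: ev.
have h' : ~~ (wsrc Y <= k < wtgt Y) by rewrite -es -et.
rewrite (factor_out h) (factor_out h') (@factor_out (comp d.+1 X Y)) //.
have -> : clamp Y k = clamp X k by apply: ord_inj; rewrite !clampE es et.
have -> : clamp (comp d.+1 X Y) k = clamp X k by apply: ord_inj; rewrite !clampE.
by rewrite o_comp.
Qed.

(** All indices are run through, whatever the range of [X], so that one induction on [j] treats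
    cells with different ends; the factors outside the range are identities and are absorbed. *)
Fixpoint chain X (j : nat) : E :=
  if j is j'.+1 then
    if insub j' is Some k then comp 0 (chain X j') (factor X k) else chain X j'
  else o (wsrc X).

Lemma chainS X (k : 'I_n) : chain X k.+1 = comp 0 (chain X k) (factor X k).
Proof. by rewrite /= valK. Qed.

Lemma chainSE X j (hj : j < n) :
  chain X j.+1 = comp 0 (chain X j) (factor X (Ordinal hj)).
Proof. exact: (chainS X (Ordinal hj)). Qed.

Lemma chain_bds X j : j <= n ->
  bd false 0 (chain X j) = o (wsrc X) /\ bd true 0 (chain X j) = o (clamp X j).
Proof.
elim: j => [|j IH] hj.
  rewrite /= !obd; split=> //; congr o; apply: ord_inj.
  by rewrite clampE; have := wle X; lia.
have [e1 e2] := IH (ltnW hj); rewrite (chainS X (Ordinal hj)).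
have c : composable 0 (chain X j) (factor X (Ordinal hj)).
  by rewrite /composable e2 factor_src.
by rewrite bd_comp_src // bd_comp_tgt // factor_tgt.
Qed.

Lemma chain_composable X (k : 'I_n) : composable 0 (chain X k) (factor X k).
Proof.
by rewrite /composable factor_src; case: (chain_bds X (ltnW (ltn_ord k))).
Qed.

Lemma chain_bd a d X j : j <= n ->
  chain (bd a d.+1 X) j = bd a d.+1 (chain X j).
Proof.
elim: j => [|j IH] hj; first by rewrite /= o_fix.
rewrite !(chainS _ (Ordinal hj)) bd_comp //;
  last exact: (chain_composable X (Ordinal hj)).
by rewrite IH ?factor_bd // ltnW.
Qed.

(** Each step is the interchange law between composition along objects and along dimension
    [d.+1]. *)
Lemma chain_comp d X Y j : composable d.+1 X Y -> j <= n ->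
  chain (comp d.+1 X Y) j = comp d.+1 (chain X j) (chain Y j).
Proof.
move=> c; have [es et ev] := composableS c; elim: j => [|j IH] hj.
  by rewrite /= -es o_comp.
pose k := Ordinal hj.
have e := IH (ltnW hj).
rewrite !(chainS _ k) (IH (ltnW hj)) factor_comp // interchange //.
- by rewrite -!chain_bd 1?ltnW // c.
- by rewrite -!factor_bd c.
- rewrite -factor_comp // -[chain X k]/(chain X j) -e.
  by apply: (chain_composable _ k).
Qed.

Lemma chain_wobj i j : chain (wobj C i) j = o i.
Proof.
elim: j => //= j ->; case: insubP => // k _ _.
rewrite factor_out /=; last by apply/negP; lia.
have -> : clamp (wobj C i) k = i by apply: ord_inj; rewrite clampE /=; lia.
exact: o_comp.
Qed.

Lemma chain_comp0l X Y j : wtgt X = wsrc Y -> j <= wtgt X ->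
  chain (comp 0 X Y) j = chain X j.
Proof.
move=> e; have -> : comp 0 X Y = wcomp0 e by apply: wcomp0E.
have hY := wle Y; have en : wtgt X = wsrc Y :> nat by rewrite e.
elim: j => [|j IH] hj //.
have hjn : j < n by have := ltn_ord (wtgt X); lia.
rewrite (chainSE (wcomp0 e) hjn) (chainSE X hjn) (IH (ltnW hj)); congr comp.
case: (boolP (wsrc X <= j < wtgt X)) => h.
  have h' : wsrc (wcomp0 e) <= Ordinal hjn < wtgt (wcomp0 e) by rewrite /=; lia.
  by rewrite (factor_in h') (@wcomp0_vall _ _ _ _ e (Ordinal hjn) h' h) -factor_in.
rewrite !factor_out //=; last by lia.
by congr o; apply: ord_inj; rewrite !clampE /=; have := wle X; lia.
Qed.

Lemma chain_low X j : j <= wsrc X -> chain X j = o (wsrc X).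
Proof.
elim: j => //= j IH hj; rewrite (IH (ltnW hj)).
case: insubP => // k _ ek; have {}ek : k = j :> nat by [].
rewrite factor_out; last by lia.
have -> : clamp X k = wsrc X by apply: ord_inj; rewrite clampE; have := wle X; lia.
exact: o_comp.
Qed.

Lemma chain_high X j : wtgt X <= j -> chain X j = chain X (wtgt X).
Proof.
elim: j => [|j IH]; first by rewrite leqn0 => /eqP ->.
rewrite leq_eqVlt => /orP [/eqP -> //|hj] /=; rewrite IH //.
case: insubP => // k _ ek; have {}ek : k = j :> nat by [].
rewrite factor_out; last by lia.
have <- : bd true 0 (chain X (wtgt X)) = o (clamp X k).
  have hn : wtgt X <= n by rewrite -ltnS.
  rewrite (chain_bds X hn).2; congr o; apply: ord_inj.
  by rewrite !clampE; have := wle X; lia.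
exact: comp_idr.
Qed.

(** The induction effectively starts at the junction [j = wtgt X], where [chain Y j] is still an
    identity; each later factor belongs to [Y] and is attached by associativity. *)
Lemma chain_comp0r X Y j : wtgt X = wsrc Y -> wtgt X <= j <= n ->
  chain (comp 0 X Y) j = comp 0 (chain X (wtgt X)) (chain Y j).
Proof.
move=> e; have hY := wle Y; have en : wtgt X = wsrc Y :> nat by rewrite e.
elim: j => [|j IH] /andP [h1 h2].
  rewrite chain_comp0l // [chain Y _]/= -e.
  have -> : wtgt X = 0 :> nat by lia.
  rewrite -{1}[chain X 0](comp_idr 0) (chain_bds X (leq0n n)).2.
  by congr (comp _ _ (o _)); apply: ord_inj; rewrite clampE; have := wle X; lia.
move: h1; rewrite leq_eqVlt => /orP [/eqP h1|h1].
  rewrite -h1 chain_comp0l // [X in comp 0 _ X]chain_low ?e // -e.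
  have hn : wtgt X <= n by lia.
  rewrite -{1}[chain X _](comp_idr 0) (chain_bds X hn).2.
  by congr (comp _ _ (o _)); apply: ord_inj; rewrite clampE; have := wle X; lia.
have hj : wtgt X <= j <= n by lia.
rewrite (chainSE (comp 0 X Y) h2) (chainSE Y h2) (IH hj).
have hn : wtgt X <= n by lia.
have -> : factor (comp 0 X Y) (Ordinal h2) = factor Y (Ordinal h2).
  have -> : comp 0 X Y = wcomp0 e by apply: wcomp0E.
  case: (boolP (wsrc Y <= j < wtgt Y)) => h.
    have h' : wsrc (wcomp0 e) <= Ordinal h2 < wtgt (wcomp0 e).
      by have := wle X; rewrite /= e; lia.
    by rewrite (factor_in h') (@wcomp0_valr _ _ _ _ e (Ordinal h2) h' h) -factor_in.
  rewrite !factor_out //=; last by have := wle X; move: h; rewrite -e; lia.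
  by congr o; apply: ord_inj; rewrite !clampE /= -e; have := wle X; lia.
rewrite comp_assoc //.
- rewrite (chain_bds X hn).2 (chain_bds Y (ltnW h2)).1 -e; congr o; apply: ord_inj.
  by rewrite clampE; have := wle X; lia.
- exact: (chain_composable Y (Ordinal h2)).
Qed.

Definition wdesc_fun X : E := chain X n.

Lemma wdesc_bd a d X : wdesc_fun (bd a d X) = bd a d (wdesc_fun X).
Proof.
rewrite /wdesc_fun; case: d => [|d]; last exact: chain_bd.
rewrite [LHS]chain_wobj; case: a; last by rewrite (chain_bds X (leqnn n)).1.
rewrite (chain_bds X (leqnn n)).2; congr o; apply: ord_inj.
by rewrite clampE; have := wle X; have := ltn_ord (wtgt X); lia.
Qed.

Lemma wdesc_comp d X Y : composable d X Y ->
  wdesc_fun (comp d X Y) = comp d (wdesc_fun X) (wdesc_fun Y).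
Proof.
rewrite /wdesc_fun; case: d => [|d] c; last exact: chain_comp.
have hn : wtgt X <= n <= n by have := ltn_ord (wtgt X); lia.
rewrite chain_comp0r //; last exact: composable0.
by rewrite [chain X n]chain_high //; lia.
Qed.

Definition wdesc : functor (wedge C) E := Functor wdesc_bd wdesc_comp.

Lemma wdesc_obj i : wdesc (wobj C i) = o i.
Proof. exact: chain_wobj. Qed.

Lemma wdesc_one k (x : C k) : wdesc (wone x) = s x.
Proof.
have e : wtgt (wone x) = hi k by [].
rewrite /= /wdesc_fun chain_high; last by rewrite e hiE.
rewrite e hiE chainS chain_low ?loE // (factor_in (X := wone x) (wone_dom k)).
by rewrite wone_val /= -(s_src x) comp_idl.
Qed.

End WedgeDesc.

(** * Hom omega-categories and codiscrete omega-categories *)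

Section Hom.
Variables (E : omegaCat) (x y : E).

(** Nothing asks [x] and [y] to be 0-cells, so a hom can be formed between any two elements; it is
    empty unless both are 0-cells. *)
Definition hom_cell := {e : E | bd false 0 e = x /\ bd true 0 e = y}.

Implicit Types u v w : hom_cell.

Lemma hom_eq u v : sval u = sval v -> u = v.
Proof.
case: u v => [a p] [b q] /= e; case: _ / e q => q.
by congr exist; apply: Prop_irrelevance.
Qed.

Lemma hom_bd_subproof a d u :
  bd false 0 (bd a d.+1 (sval u)) = x /\ bd true 0 (bd a d.+1 (sval u)) = y.
Proof. by rewrite !bd_lt //; exact: (svalP u). Qed.

Definition hom_bd a d u : hom_cell := exist _ _ (hom_bd_subproof a d u).

Lemma hom_comp_subproof d u v : composable d.+1 (sval u) (sval v) ->
  bd false 0 (comp d.+1 (sval u) (sval v)) = x /\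
  bd true 0 (comp d.+1 (sval u) (sval v)) = y.
Proof.
move=> c; have [e1 e2] := svalP u; have [f1 f2] := svalP v.
have id_comp (z : E) a : comp d.+1 (bd a 0 z) (bd a 0 z) = bd a 0 z.
  have {1}<- : bd false d.+1 (bd a 0 z) = bd a 0 z by apply: bd_ge.
  exact: comp_idl.
split; rewrite bd_comp //.
  by rewrite e1 f1 -e1 id_comp.
by rewrite e2 f2 -e2 id_comp.
Qed.

(** For a pair that is not composable, the junk composite of [E] may have other ends, so a value
    inside the subtype has to be chosen. *)
Definition hom_comp d u v : hom_cell :=
  match pselect (composable d.+1 (sval u) (sval v)) with
  | left c => exist _ _ (hom_comp_subproof c)
  | right _ => u
  end.

Lemma hom_compE d u v : composable d.+1 (sval u) (sval v) ->
  sval (hom_comp d u v) = comp d.+1 (sval u) (sval v).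
Proof. by rewrite /hom_comp; case: pselect. Qed.

Lemma hom_composable d u v : hom_bd true d u = hom_bd false d v ->
  composable d.+1 (sval u) (sval v).
Proof. by move/(congr1 sval). Qed.

Lemma hom_bd_bd a b j k u :
  hom_bd a j (hom_bd b k u) = if j < k then hom_bd a j u else hom_bd b k u.
Proof. by apply: hom_eq; rewrite /= bd_bd ltnS; case: ifP. Qed.

Lemma hom_comp_idl k u : hom_comp k (hom_bd false k u) u = u.
Proof.
apply: hom_eq; rewrite hom_compE /= ?comp_idl //.
exact: bd_ge.
Qed.

Lemma hom_comp_idr k u : hom_comp k u (hom_bd true k u) = u.
Proof.
apply: hom_eq; rewrite hom_compE /= ?comp_idr //.
by apply/esym; apply: bd_ge.
Qed.

Lemma hom_bd_comp_src k u v : hom_bd true k u = hom_bd false k v ->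
  hom_bd false k (hom_comp k u v) = hom_bd false k u.
Proof.
by move/hom_composable=> c; apply: hom_eq; rewrite /= hom_compE // bd_comp_src.
Qed.

Lemma hom_bd_comp_tgt k u v : hom_bd true k u = hom_bd false k v ->
  hom_bd true k (hom_comp k u v) = hom_bd true k v.
Proof.
by move/hom_composable=> c; apply: hom_eq; rewrite /= hom_compE // bd_comp_tgt.
Qed.

Lemma hom_bd_comp a j k u v : j != k -> hom_bd true k u = hom_bd false k v ->
  hom_bd a j (hom_comp k u v) = hom_comp k (hom_bd a j u) (hom_bd a j v).
Proof.
move=> jk c; have c' := hom_composable c.
have c2 : composable k.+1 (sval (hom_bd a j u)) (sval (hom_bd a j v)).
  case: (ltngtP j k) jk => // jk _ /=.
    have jk' : j.+1 < k.+1 by [].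
    rewrite /composable !bd_ge 1?ltnW //.
    by rewrite -(bd_lt a true (sval u) jk') c' bd_lt.
  by rewrite /composable !bd_lt.
by apply: hom_eq; rewrite hom_compE //= hom_compE // bd_comp.
Qed.

Lemma hom_comp_assoc k u v w :
  hom_bd true k u = hom_bd false k v -> hom_bd true k v = hom_bd false k w ->
  hom_comp k (hom_comp k u v) w = hom_comp k u (hom_comp k v w).
Proof.
move=> /hom_composable c /hom_composable d.
have c' : composable k.+1 (sval (hom_comp k u v)) (sval w).
  by rewrite hom_compE // /composable bd_comp_tgt.
have d' : composable k.+1 (sval u) (sval (hom_comp k v w)).
  by rewrite hom_compE // /composable bd_comp_src.
apply: hom_eq; rewrite (hom_compE c') (hom_compE d') (hom_compE c) (hom_compE d).
exact: comp_assoc.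
Qed.

Lemma hom_interchange j k u v w t : j < k ->
  hom_bd true k u = hom_bd false k v -> hom_bd true k w = hom_bd false k t ->
  hom_bd true j (hom_comp k u v) = hom_bd false j (hom_comp k w t) ->
  hom_comp j (hom_comp k u v) (hom_comp k w t) =
  hom_comp k (hom_comp j u w) (hom_comp j v t).
Proof.
move=> jk /hom_composable c /hom_composable d /hom_composable f.
have jk' : j.+1 < k.+1 by [].
(* Composition along [k.+1] leaves the boundaries of the lower dimension [j.+1] unchanged, so that
   composability of the two composites yields that of their factors. *)
have low (e e' : E) a b : bd a k.+1 e = bd b k.+1 e' ->
    forall z, bd z j.+1 e = bd z j.+1 e'.
  by move=> h z; rewrite -(bd_lt z a e jk') h bd_lt.
have f' : composable j.+1 (comp k.+1 (sval u) (sval v)) (comp k.+1 (sval w) (sval t)).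
  by move: f; rewrite !hom_compE.
have src (e e' : E) : composable k.+1 e e' ->
    forall z, bd z j.+1 (comp k.+1 e e') = bd z j.+1 e.
  by move=> h z; apply: low (bd_comp_src h) z.
have tgt (e e' : E) : composable k.+1 e e' ->
    forall z, bd z j.+1 (comp k.+1 e e') = bd z j.+1 e'.
  by move=> h z; apply: low (bd_comp_tgt h) z.
have c1 : composable j.+1 (sval u) (sval w).
  by move: f'; rewrite /composable !src.
have c2 : composable j.+1 (sval v) (sval t).
  by move: f'; rewrite /composable !tgt.
have kj : k.+1 != j.+1 by rewrite neq_ltn jk' orbT.
have g : composable k.+1 (sval (hom_comp j u w)) (sval (hom_comp j v t)).
  by rewrite !hom_compE // /composable !bd_comp // c d.
apply: hom_eq; rewrite (hom_compE f) (hom_compE g) !(hom_compE c, hom_compE d).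
by rewrite (hom_compE c1) (hom_compE c2) interchange.
Qed.

Lemma hom_fin_dim u : exists k, hom_bd false k u = u.
Proof.
have [k hk] := fin_dim (sval u); exists k; apply: hom_eq.
by apply: bd_fix hk _.
Qed.

(** Dimensions are lowered by one: composition in dimension [d] is that of [E] in
    dimension [d+1]. *)
Definition hom : omegaCat :=
  OmegaCat hom_bd_bd hom_comp_idl hom_comp_idr hom_bd_comp_src hom_bd_comp_tgt
    hom_bd_comp hom_comp_assoc hom_interchange hom_fin_dim.

Section HomFunctor.
Variables (C : omegaCat) (f : C -> E).
Hypothesis f_src : forall z, bd false 0 (f z) = x.
Hypothesis f_tgt : forall z, bd true 0 (f z) = y.
Hypothesis f_bd : forall a d z, f (bd a d z) = bd a d.+1 (f z).
Hypothesis f_comp : forall d z z', composable d z z' ->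
  f (comp d z z') = comp d.+1 (f z) (f z').

Let to_hom_fun z : hom := exist _ (f z) (conj (f_src z) (f_tgt z)).

Lemma to_hom_bd a d z : to_hom_fun (bd a d z) = bd a d (to_hom_fun z).
Proof. by apply: hom_eq => /=. Qed.

Lemma to_hom_comp d z z' : composable d z z' ->
  to_hom_fun (comp d z z') = comp d (to_hom_fun z) (to_hom_fun z').
Proof.
move=> c; apply: hom_eq; rewrite /= hom_compE /=; first exact: f_comp.
by rewrite /composable -!f_bd c.
Qed.

Definition to_hom : functor C hom := Functor to_hom_bd to_hom_comp.

End HomFunctor.

Section HomValues.
Variables (C : omegaCat) (F : functor C hom).

Lemma hom_val_bd a d z : sval (F (bd a d z)) = bd a d.+1 (sval (F z)).
Proof. by rewrite fmap_bd. Qed.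

Lemma hom_val_comp d z z' : composable d z z' ->
  sval (F (comp d z z')) = comp d.+1 (sval (F z)) (sval (F z')).
Proof.
move=> c; rewrite fmap_comp //= hom_compE //.
by rewrite /composable -!hom_val_bd c.
Qed.

End HomValues.
End Hom.

Section Codiscrete.
Variable S : Type.
Implicit Types p q r : (S * S)%type.

Definition codisc_bd (a : bool) (d : nat) p :=
  if d is 0 then (if a then (p.2, p.2) else (p.1, p.1)) else p.

Definition codisc_comp (d : nat) p q := if d is 0 then (p.1, q.2) else p.

Lemma codisc_bd_bd a b j k p : codisc_bd a j (codisc_bd b k p) =
  if j < k then codisc_bd a j p else codisc_bd b k p.
Proof. by case: j k a b => [|j] [|k] [] [] //=; case: ifP. Qed.

Lemma codisc_idl k p : codisc_comp k (codisc_bd false k p) p = p.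
Proof. by case: k p => [|k] []. Qed.

Lemma codisc_idr k p : codisc_comp k p (codisc_bd true k p) = p.
Proof. by case: k p => [|k] []. Qed.

Lemma codisc_comp_src k p q : codisc_bd true k p = codisc_bd false k q ->
  codisc_bd false k (codisc_comp k p q) = codisc_bd false k p.
Proof. by case: k. Qed.

Lemma codisc_comp_tgt k p q : codisc_bd true k p = codisc_bd false k q ->
  codisc_bd true k (codisc_comp k p q) = codisc_bd true k q.
Proof. by case: k. Qed.

Lemma codisc_compN a j k p q : j != k -> codisc_bd true k p = codisc_bd false k q ->
  codisc_bd a j (codisc_comp k p q) =
  codisc_comp k (codisc_bd a j p) (codisc_bd a j q).
Proof. by case: j k => [|j] [|k]. Qed.

Lemma codisc_assoc k p q r :
  codisc_bd true k p = codisc_bd false k q ->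
  codisc_bd true k q = codisc_bd false k r ->
  codisc_comp k (codisc_comp k p q) r = codisc_comp k p (codisc_comp k q r).
Proof. by case: k. Qed.

Lemma codisc_interchange j k p q r t : j < k ->
  codisc_bd true k p = codisc_bd false k q ->
  codisc_bd true k r = codisc_bd false k t ->
  codisc_bd true j (codisc_comp k p q) = codisc_bd false j (codisc_comp k r t) ->
  codisc_comp j (codisc_comp k p q) (codisc_comp k r t) =
  codisc_comp k (codisc_comp j p r) (codisc_comp j q t).
Proof. by case: j k => [|j] [|k]. Qed.

Lemma codisc_fin_dim p : exists k, codisc_bd false k p = p.
Proof. by exists 1. Qed.

(** There is exactly one cell between any two elements of [S]; hence a functor
    from a wedge to [codisc S] is a map from its objects to [S]. *)
Definition codisc : omegaCat :=
  OmegaCat codisc_bd_bd codisc_idl codisc_idr codisc_comp_src codisc_comp_tgt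
    codisc_compN codisc_assoc codisc_interchange codisc_fin_dim.

Variables (n : nat) (C : 'I_n -> omegaCat) (f : 'I_n.+1 -> S).

Let to_codisc_fun (X : wedge C) : codisc := (f (wsrc X), f (wtgt X)).

Lemma to_codisc_bd a d X : to_codisc_fun (bd a d X) = bd a d (to_codisc_fun X).
Proof. by case: d a => [|d] []. Qed.

Lemma to_codisc_comp d X Y : composable d X Y ->
  to_codisc_fun (comp d X Y) = comp d (to_codisc_fun X) (to_codisc_fun Y).
Proof.
case: d => [|d] //.
by move/composable0=> e; rewrite [comp 0 X Y](wcomp0E e).
Qed.

Definition to_codisc : functor (wedge C) codisc :=
  Functor to_codisc_bd to_codisc_comp.

End Codiscrete.

(** * Functors out of the cylinder *)

Section CylinderCells.
Variables (n : nat) (C : 'I_n -> omegaCat) (K : forall i, cylData (C i)).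

Definition opt_pt (o : option 'I_n) (e : o = None) : optfam C o :=
  eq_rect None (optfam C) (wobj _ ord0) o (esym e).

Lemma optfam_diag (q : 'I_n.+1) (x y : optfam C (unlift q q)) : x = y.
Proof. by move: x y; rewrite unlift_none => x y; apply: point_eq. Qed.

Lemma optF_surj o i (h : forall i', o = Some i' -> i' = i) (x : optfam C o) :
  o = Some i -> exists x', x = optF C h x'.
Proof.
case: o h x => //= i' h x [e]; subst i'; exists x.
by rewrite (Prop_irrelevance (h _ _) erefl).
Qed.

(** The cell of [Pcat C q] given by its component [0]. *)
Definition point_cell (q : 'I_n.+1) : Pcat C q :=
  @wone _ (fun j => optfam C (unlift q j)) q (opt_pt (unlift_none q)).

(** The hypotheses [hs] and [ht] exclude the component that the face splits in two. *)
Lemma face_one q b k j (x : C k)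
    (hs : lift (omit q b) (lo k) = lo j) (ht : lift (omit q b) (hi k) = hi j)
    (h : lift (omit q b) (lo k) <= j < lift (omit q b) (hi k)) :
  face C q b (wone x) =
  @wone _ (fun j => optfam C (unlift q j)) j (optF C (face_idx h) x).
Proof.
have hj : wsrc (face C q b (wone x)) <= j < wtgt (face C q b (wone x)) by [].
rewrite (@woneP _ _ (face C q b (wone x)) j hs ht hj); congr wone.
rewrite -[in RHS](wone_val x (wone_dom k)).
exact: wmap_val.
Qed.

Lemma face_wobj q b i : face C q b (wobj C i) = wobj _ (lift (omit q b) i).
Proof. by apply: wcell_eq => // j h h'; exfalso; move: h'; rewrite /=; lia. Qed.

(** This face omits the object [k+1], so [C k] goes to the interval from [k] to [k+2], whose entries
    are [[0]] and [C k] in this order; a tuple with two entries is a composite along the middle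
    object. In [face_split_hi] the two entries come in the other order. *)
Lemma face_split_lo k (x : C k) : face C (lo k) false (wone x) =
  comp 0 (point_cell (lo k)) (face C (lo k) true (wone x)).
Proof.
have c : wtgt (point_cell (lo k)) = wsrc (face C (lo k) true (wone x)).
  by apply: ord_inj; rewrite /= /bump /=; lia.
have -> : comp 0 (point_cell (lo k)) (face C (lo k) true (wone x)) = wcomp0 c.
  exact: wcomp0E.
have es : wsrc (face C (lo k) false (wone x)) = wsrc (wcomp0 c).
  by apply: ord_inj; rewrite /= /bump /=; lia.
have et : wtgt (face C (lo k) false (wone x)) = wtgt (wcomp0 c).
  by apply: ord_inj; rewrite /= /bump /=; lia.
apply: wcell_eq => // j h h'.
case: (wcomp0_case c h') => hj.
  by have e := wone_idx hj; subst j; apply: optfam_diag.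
rewrite (@wcomp0_valr _ _ _ _ c _ h' hj).
have -> : wval h = optF C (face_idx h) x.
  by rewrite -[in RHS](wone_val x (wone_dom k)); apply: wmap_val.
have -> : wval hj = optF C (face_idx hj) x.
  by rewrite -[in RHS](wone_val x (wone_dom k)); apply: wmap_val.
by congr (fmap _ _); apply: optF_irr.
Qed.

Lemma face_split_hi k (x : C k) : face C (hi k) true (wone x) =
  comp 0 (face C (hi k) false (wone x)) (point_cell (hi k)).
Proof.
have c : wtgt (face C (hi k) false (wone x)) = wsrc (point_cell (hi k)).
  by apply: ord_inj; rewrite /= /bump /=; lia.
have -> : comp 0 (face C (hi k) false (wone x)) (point_cell (hi k)) = wcomp0 c.
  exact: wcomp0E.
have es : wsrc (face C (hi k) true (wone x)) = wsrc (wcomp0 c).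
  by apply: ord_inj; rewrite /= /bump /=; lia.
have et : wtgt (face C (hi k) true (wone x)) = wtgt (wcomp0 c).
  by apply: ord_inj; rewrite /= /bump /=; lia.
apply: wcell_eq => // j h h'.
case: (wcomp0_case c h') => hj; last first.
  by have e := wone_idx hj; subst j; apply: optfam_diag.
rewrite (@wcomp0_vall _ _ _ _ c _ h' hj).
have -> : wval h = optF C (face_idx h) x.
  by rewrite -[in RHS](wone_val x (wone_dom k)); apply: wmap_val.
have -> : wval hj = optF C (face_idx hj) x.
  by rewrite -[in RHS](wone_val x (wone_dom k)); apply: wmap_val.
by congr (fmap _ _); apply: optF_irr.
Qed.

Lemma face_split_lo_composable k (x : C k) :
  composable 0 (point_cell (lo k)) (face C (lo k) true (wone x)).
Proof.
by congr (wobj _ _); apply: ord_inj; rewrite /= /bump /=; lia.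
Qed.

Lemma face_split_hi_composable k (x : C k) :
  composable 0 (face C (hi k) false (wone x)) (point_cell (hi k)).
Proof.
by congr (wobj _ _); apply: ord_inj; rewrite /= /bump /=; lia.
Qed.

Definition qfam_in b (i : 'I_n) (e : bool) : functor (C i) (qfam K b i) :=
  if b as b return functor (C i) (qfam K b i)
  then cyl_in (K i) e else idF (C i).

(** The test [k == k] does not reduce for a variable [k], hence the transport; with a variable
    boolean it can be removed by case analysis on [h]. *)
Definition qcast b (i : 'I_n) (h : true = b) (y : K i) : qfam K b i :=
  eq_rect true (fun b => qfam K b i) y b h.

Lemma qin_one k e i (x : C i) : qin K k e (wone x) =
  @wone _ (fun i => qfam K (i == k) i) i (qfam_in (i == k) i e x).
Proof.
have h := wone_dom i.
rewrite (@woneP _ _ (qin K k e (wone x)) i erefl erefl h); congr wone.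
rewrite -[in RHS](wone_val x (wone_dom i)).
exact: (@wedge_id_val _ _ _ (fun i => qfam_in (i == k) i e) (wone x) i h
          (wone_dom i)).
Qed.

Lemma qin_wobj k e i : qin K k e (wobj C i) = wobj _ i.
Proof. by apply: wcell_eq => // j h h'; exfalso; move: h'; rewrite /=; lia. Qed.

(** The 1-cell of the cylinder joining the two copies of the object [q]. *)
Definition arr (q : 'I_n.+1) : cyl_step K := cyl_P K q (point_cell q).

(** The cell of [Q_(k+1)] given by its component [K k]. *)
Definition cone k (y : K k) : cyl_step K :=
  cyl_Q K k (@wone _ (fun i => qfam K (i == k) i) k (qcast (esym (eqxx k)) y)).

Lemma cone_bd k a d (y : K k) : cone (bd a d y) = bd a d.+1 (cone y).
Proof.
rewrite /cone -fmap_bd -wone_bd; congr (fmap _ _); congr wone.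
by case: _ / (esym (eqxx k)).
Qed.

Lemma cone_comp k d (y z : K k) : composable d y z ->
  cone (comp d y z) = comp d.+1 (cone y) (cone z).
Proof.
move=> c; rewrite /cone -fmap_comp.
  by rewrite -wone_comp; congr (fmap _ _); congr wone; case: _ / (esym (eqxx k)).
rewrite /composable -!wone_bd; congr wone.
by case: _ / (esym (eqxx k)).
Qed.

Lemma cyl_faceE q b X : cyl_face K q b X = cyl_P K q (face C q b X).
Proof. by []. Qed.

Lemma cyl_inE (e : bool) X :
  cyl_in (cyl_step K) e X = cyl_face K (if e then ord0 else ord_max) e X.
Proof. by case: e. Qed.

(** The picture behind this and the next lemma: in the cylinder, [P_q] runs along the end 0 up to
    the vertex [q], crosses to the end 1 by its inserted [[0]], and continues along the end 1. *)
Lemma cyl_face_in_false (q : 'I_n.+1) (X : wcell C) : wtgt X <= q ->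
  cyl_face K q false X = cyl_in (cyl_step K) false X.
Proof. by move=> h; rewrite cyl_inE; apply/esym/cyl_face_false. Qed.

Lemma cyl_face_in_true (q : 'I_n.+1) (X : wcell C) : q <= wsrc X ->
  cyl_face K q true X = cyl_in (cyl_step K) true X.
Proof. by move=> h; rewrite cyl_inE; apply/esym/cyl_face_true. Qed.

Lemma cone_src k (y : K k) :
  bd false 0 (cone y) = cyl_in (cyl_step K) false (wobj C (lo k)).
Proof.
rewrite /cone -fmap_bd wone_src -(qin_wobj k true) -(cyl_glue K k true).
exact: cyl_face_in_false.
Qed.

Lemma cone_tgt k (y : K k) :
  bd true 0 (cone y) = cyl_in (cyl_step K) true (wobj C (hi k)).
Proof.
rewrite /cone -fmap_bd wone_tgt -(qin_wobj k false) -(cyl_glue K k false).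
exact: cyl_face_in_true.
Qed.

Lemma arr_src q : bd false 0 (arr q) = cyl_in (cyl_step K) false (wobj C q).
Proof.
rewrite -(@cyl_face_in_false q) // cyl_faceE face_wobj /arr -fmap_bd wone_src.
congr (fmap _ _); congr wobj; by apply: ord_inj; rewrite /= /bump /=; lia.
Qed.

Lemma arr_tgt q : bd true 0 (arr q) = cyl_in (cyl_step K) true (wobj C q).
Proof.
rewrite -(@cyl_face_in_true q) // cyl_faceE face_wobj /arr -fmap_bd wone_tgt.
congr (fmap _ _); congr wobj; by apply: ord_inj; rewrite /= /bump /=; lia.
Qed.

Lemma arr_bd q a d : bd a d.+1 (arr q) = arr q.
Proof.
rewrite /arr -fmap_bd -wone_bd; congr (fmap _ _); congr wone.
exact: optfam_diag.
Qed.

Lemma cone_in k e (x : C k) :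
  cone (cyl_in (K k) e x) =
  cyl_face K (if e then lo k else hi k) (~~ e) (wone x).
Proof.
rewrite cyl_glue qin_one /cone; congr (fmap _ _); congr wone.
by case: _ / (esym (eqxx k)).
Qed.

(** The end 1 of the cylinder on [C k] is glued to the face of [P] that splits [C k] as [(!,id)]:
    first cross at the left vertex, then follow the end 1. Dually, [cone_in_false] follows the end 0
    and crosses at the right vertex. *)
Lemma cone_in_true k (x : C k) : cone (cyl_in (K k) true x) =
  comp 0 (arr (lo k)) (cyl_in (cyl_step K) true (wone x)).
Proof.
rewrite cone_in -(@cyl_face_in_true (lo k)) // !cyl_faceE face_split_lo.
by rewrite fmap_comp //; apply: face_split_lo_composable.
Qed.

Lemma cone_in_false k (x : C k) : cone (cyl_in (K k) false x) =
  comp 0 (cyl_in (cyl_step K) false (wone x)) (arr (hi k)).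
Proof.
rewrite cone_in -(@cyl_face_in_false (hi k)) // !cyl_faceE face_split_hi.
by rewrite fmap_comp //; apply: face_split_hi_composable.
Qed.

(** The side condition on [b] is the one under which the face [b] of [P_q] becomes the end [b] of
    the cylinder; likewise in [Pcat_component]. *)
Lemma Pcat_vertex (q : 'I_n.+1) (i : 'I_n.+2) : exists b (j : 'I_n.+1),
  (if b then q <= j else j <= q) /\ wobj _ i = face C q b (wobj C j).
Proof.
have hi_n := ltn_ord i.
case: (leqP i q) => h; [exists false, (inord i) | exists true, (inord i.-1)].
  have e : @inord n i = i :> nat by rewrite inordK //; have := ltn_ord q; lia.
  rewrite face_wobj; split; first by rewrite /= e.
  by congr (wobj _ _); apply: ord_inj; rewrite /= e /bump /=; lia.
have e : @inord n i.-1 = i.-1 :> nat by rewrite inordK //; lia.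
rewrite face_wobj; split; first by rewrite /= e; lia.
by congr (wobj _ _); apply: ord_inj; rewrite /= e /bump /=; lia.
Qed.

Lemma unlift_case (q j : 'I_n.+1) : j = q \/
  exists i : 'I_n, unlift q j = Some i /\ j = (q <= i) + i :> nat.
Proof.
by case: (unliftP q j) => [i ->|->]; [right; exists i | left].
Qed.

Lemma Pcat_component (q : 'I_n.+1) j (x : optfam C (unlift q j)) :
  @wone _ (fun j => optfam C (unlift q j)) j x = point_cell q :> wcell _ \/
  exists b (i : 'I_n) (x' : C i), (if b then q <= i else i < q) /\
    @wone _ (fun j => optfam C (unlift q j)) j x = face C q b (wone x').
Proof.
case: (unlift_case q j) => [e|[i [eu e]]].
  subst j; left; congr wone; exact: optfam_diag.
right; exists (q <= i), i; set b := q <= i.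
have hs : lift (omit q b) (lo i) = lo j.
  by apply: ord_inj; rewrite /omit /b; case: leqP => h; rewrite /= /bump /= e; lia.
have ht : lift (omit q b) (hi i) = hi j.
  by apply: ord_inj; rewrite /omit /b; case: leqP => h; rewrite /= /bump /= e; lia.
have h : lift (omit q b) (lo i) <= j < lift (omit q b) (hi i).
  by rewrite hs ht wone_dom.
have [x' ex] : exists x', x = optF C (face_idx h) x'.
  by exact: optF_surj.
exists x'; split; first by rewrite /b; case: leqP.
by rewrite ex (face_one x' hs ht).
Qed.

(** Away from the component [k] the two maps from [T] to [Q_k] agree; the quantifier over [a] leaves
    the choice between them open, so that the one glued to the suitable face can be used. *)
Lemma Qcat_component (k i : 'I_n) (x : qfam K (i == k) i) :
  (exists (e : i = k) (y : K i),
    x = qcast (esym (introT eqP e)) y) \/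
  exists b (x' : C i), (if b then k < i else i < k) /\
    forall a, @wone _ (fun i => qfam K (i == k) i) i x = qin K k a (wone x').
Proof.
have key b (z : qfam K b i) : (exists (h : true = b) (y : K i), z = qcast h y) \/
    b = false /\ exists x', forall a, z = qfam_in b i a x'.
  by case: b z => z; [left; exists erefl, z | right; split=> //; exists z].
case: (key _ x) => [[h [y ex]]|[h [x' ex]]].
  left; exists (eqP (esym h)), y; rewrite ex; congr (qcast _ _).
  exact: Prop_irrelevance.
right; exists (k < i), x'; split; last by move=> a; rewrite qin_one -ex.
have hn : (i : nat) != k by apply/negP => /eqP/ord_inj e; rewrite e eqxx in h.
by case: ltngtP hn.
Qed.

End CylinderCells.

Lemma compFE (C D E : omegaCat) (G : functor D E) (F : functor C D) x :
  compF G F x = G (F x).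
Proof. by []. Qed.

(** * The universal property of the cylinder *)

Section CylinderUniversal.
Variables (n : nat) (C : 'I_n -> omegaCat) (K : forall i, cylData (C i)).

Lemma cyl_face_shift (b : bool) (q : 'I_n.+1) X :
  (if b then q <= wsrc X else wtgt X <= q) ->
  cyl_P K q (face C q b X) = cyl_in (cyl_step K) b X.
Proof.
by case: b => h; rewrite -cyl_faceE;
  [apply: cyl_face_in_true | apply: cyl_face_in_false].
Qed.

(** The negation comes from the gluing: the inclusion [~~ b] into [Q_k] is glued to the face [b] of
    a [P], and for [X] on the given side of [k] that face is the end [b]. *)
Lemma cyl_qin (b : bool) (k : 'I_n) X :
  (if b then hi k <= wsrc X else wtgt X <= lo k) ->
  cyl_Q K k (qin K k (~~ b) X) = cyl_in (cyl_step K) b X.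
Proof.
move=> h; rewrite -cyl_glue negbK cyl_faceE.
rewrite -(@cyl_face_shift b (if b then hi k else lo k)).
  by case: b h.
by case: b h.
Qed.

(** All vertices and components of the [P_q] and [Q_k] lie in one of the two ends, apart from the
    inserted point of [P_q] and the component [k] of [Q_k], which give the arrows and the cones. *)
Lemma cyl_ext (E : omegaCat) (F G : functor (cyl_step K) E) :
  (forall e X, F (cyl_in (cyl_step K) e X) = G (cyl_in (cyl_step K) e X)) ->
  (forall q, F (arr K q) = G (arr K q)) ->
  (forall k (y : K k), F (cone y) = G (cone y)) -> F =1 G.
Proof.
move=> Hin Harr Hcone; apply: colim_ext => -[q|k]; apply: wedge_ext.
- move=> i; have [b [j [hb e]]] := Pcat_vertex C q i.
  change (F (cyl_P K q (wobj _ i)) = G (cyl_P K q (wobj _ i))).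
  by rewrite e cyl_face_shift.
- move=> j x; set X := (X in compF F _ X).
  change (F (cyl_P K q X) = G (cyl_P K q X)); rewrite {}/X.
  have [e|[b [i [x' [hb e]]]]] := Pcat_component x; first by rewrite e Harr.
  by rewrite e cyl_face_shift //; case: b hb {e}; rewrite ?hiE.
- move=> i; change (F (cyl_Q K k (wobj _ i)) = G (cyl_Q K k (wobj _ i))).
  rewrite -(qin_wobj K k (~~ (k < i))) cyl_qin //.
  by case: (leqP i k) => h /=; rewrite ?hiE.
- move=> i x; set X := (X in compF F _ X).
  change (F (cyl_Q K k X) = G (cyl_Q K k X)); rewrite {}/X.
  have [[e [y ex]]|[b [x' [hb ex]]]] := Qcat_component x.
    subst i; have := Hcone k y; rewrite /cone ex.
    by rewrite (Prop_irrelevance (esym (eqxx k)) (esym (introT eqP erefl))).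
  by rewrite (ex (~~ b)) cyl_qin.
Qed.

Section Desc.
Variables (E : omegaCat) (h : bool -> functor (wedge C) E) (f : 'I_n.+1 -> E).
Variable g : forall k,
  functor (K k) (hom (h false (wobj C (lo k))) (h true (wobj C (hi k)))).
Hypothesis f_src : forall q, bd false 0 (f q) = h false (wobj C q).
Hypothesis f_tgt : forall q, bd true 0 (f q) = h true (wobj C q).
Hypothesis f_bd : forall q a d, bd a d.+1 (f q) = f q.
Hypothesis g_true : forall k (x : C k), sval (g k (cyl_in (K k) true x)) =
  comp 0 (f (lo k)) (h true (wone x)).
Hypothesis g_false : forall k (x : C k), sval (g k (cyl_in (K k) false x)) =
  comp 0 (h false (wone x)) (f (hi k)).

Lemma end_obj_bd e i a d : bd a d (h e (wobj C i)) = h e (wobj C i).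
Proof. by apply: (@bd_fix _ a _ _ 0) => //; rewrite -fmap_bd; case: a. Qed.

(** The vertex [q] of [T] occurs twice in [P_q], once in each end; the predecessor corrects the
    resulting shift in the end 1. *)
Definition P_obj_map (q : 'I_n.+1) (j : 'I_n.+2) : E :=
  if j <= q then h false (wobj C (inord j)) else h true (wobj C (inord j.-1)).

Lemma P_obj_false (q : 'I_n.+1) (j : 'I_n.+2) (i : 'I_n.+1) :
  j = i :> nat -> j <= q ->
  P_obj_map q j = h false (wobj C i).
Proof.
move=> e hj; rewrite /P_obj_map hj; congr (fmap _ _); congr wobj.
by apply: ord_inj; rewrite e inordK.
Qed.

Lemma P_obj_true (q : 'I_n.+1) (j : 'I_n.+2) (i : 'I_n.+1) :
  j = i.+1 :> nat -> q < j ->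
  P_obj_map q j = h true (wobj C i).
Proof.
move=> e hj; rewrite /P_obj_map leqNgt hj; congr (fmap _ _); congr wobj.
by apply: ord_inj; rewrite e /= inordK.
Qed.

(** The option stands for [unlift q j]; as a variable it can be destructed together with the type
    that depends on it. *)
Definition opt_map (q : nat) (fq : E) (o : option 'I_n) : optfam C o -> E :=
  match o with
  | Some i => fun x => h (q <= i) (wone x)
  | None => fun=> fq
  end.

Definition P_one_map (q j : 'I_n.+1) (x : optfam C (unlift q j)) : E :=
  opt_map q (f q) x.

Lemma opt_map_optF q fq o i (H : forall i', o = Some i' -> i' = i) (x : C i) :
  o = Some i -> opt_map q fq (optF C H x) = h (q <= i) (wone x).
Proof.
move=> e; subst o => /=.
by rewrite (Prop_irrelevance (H _ _) erefl).
Qed.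

Lemma opt_map_bd q fq o a d (x : optfam C o) :
  (forall a d, bd a d.+1 fq = fq) ->
  opt_map q fq (bd a d x) = bd a d.+1 (opt_map q fq x).
Proof.
move=> hfq; case: o x => [i|] x /=; last by rewrite hfq.
by rewrite -fmap_bd wone_bd.
Qed.

Lemma opt_map_comp q fq o d (x y : optfam C o) :
  (forall a d, bd a d.+1 fq = fq) ->
  composable d x y ->
  opt_map q fq (comp d x y) = comp d.+1 (opt_map q fq x) (opt_map q fq y).
Proof.
move=> hfq; case: o x y => [i|] x y c /=; last by rewrite -{2}(hfq false d) comp_idl.
rewrite wone_comp fmap_comp //.
by rewrite /composable -!wone_bd c.
Qed.

Lemma P_one_src (q j : 'I_n.+1) (x : optfam C (unlift q j)) :
  bd false 0 (P_one_map x) = P_obj_map q (lo j).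
Proof.
rewrite /P_one_map; have [e|[i [eu e]]] := unlift_case q j.
  subst j; have -> : opt_map q (f q) x = f q by move: x; rewrite unlift_none.
  by rewrite f_src (@P_obj_false _ _ q).
move: x; rewrite eu => x /=; rewrite -fmap_bd wone_src.
case: leqP e => hq e.
  by rewrite (@P_obj_true _ _ (lo i)) // ?loE; lia.
by rewrite (@P_obj_false _ _ (lo i)) // ?loE; lia.
Qed.

Lemma P_one_tgt (q j : 'I_n.+1) (x : optfam C (unlift q j)) :
  bd true 0 (P_one_map x) = P_obj_map q (hi j).
Proof.
rewrite /P_one_map; have [e|[i [eu e]]] := unlift_case q j.
  subst j; have -> : opt_map q (f q) x = f q by move: x; rewrite unlift_none.
  by rewrite f_tgt (@P_obj_true _ _ q) ?hiE.
move: x; rewrite eu => x /=; rewrite -fmap_bd wone_tgt.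
case: leqP e => hq e.
  by rewrite (@P_obj_true _ _ (hi i)) // ?hiE; lia.
by rewrite (@P_obj_false _ _ (hi i)) // ?hiE; lia.
Qed.

Lemma P_obj_bd q i a : bd a 0 (P_obj_map q i) = P_obj_map q i.
Proof. by rewrite /P_obj_map; case: ifP => _; apply: end_obj_bd. Qed.

Lemma P_one_bd (q k : 'I_n.+1) a d (x : optfam C (unlift q k)) :
  P_one_map (bd a d x) = bd a d.+1 (P_one_map x).
Proof. by apply: opt_map_bd => a' d'; apply: f_bd. Qed.

Lemma P_one_comp (q k : 'I_n.+1) d (x y : optfam C (unlift q k)) : composable d x y ->
  P_one_map (comp d x y) = comp d.+1 (P_one_map x) (P_one_map y).
Proof. by apply: opt_map_comp => a' d'; apply: f_bd. Qed.

Definition P_desc q : functor (Pcat C q) E :=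
  wdesc (P_obj_bd q) (@P_one_src q) (@P_one_tgt q) (@P_one_bd q) (@P_one_comp q).

Lemma P_desc_point q : P_desc q (point_cell C q) = f q.
Proof.
rewrite /P_desc /point_cell wdesc_one /P_one_map.
by move: (opt_pt _ _); rewrite unlift_none.
Qed.

Lemma P_desc_obj (q : 'I_n.+1) b (i : 'I_n.+1) : (if b then q <= i else i <= q) ->
  P_desc q (face C q b (wobj C i)) = h b (wobj C i).
Proof.
move=> hb; rewrite face_wobj /P_desc wdesc_obj; case: b hb => hb.
  by rewrite (@P_obj_true _ _ i) //= /bump /=; lia.
by rewrite (@P_obj_false _ _ i) //= /bump /=; lia.
Qed.

Lemma P_desc_one (q : 'I_n.+1) b (i : 'I_n) (x : C i) : (if b then q <= i else i < q) ->
  P_desc q (face C q b (wone x)) = h b (wone x).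
Proof.
move=> hb; have eb : (q <= i) = b by case: b hb => hb; lia.
have hj : (q <= i) + i < n.+1 by have := ltn_ord i; lia.
pose j := Ordinal hj.
have hs : lift (omit q b) (lo i) = lo j.
  by apply: ord_inj; case: (b) hb => hb; rewrite /= /bump /=; lia.
have ht : lift (omit q b) (hi i) = hi j.
  by apply: ord_inj; case: (b) hb => hb; rewrite /= /bump /=; lia.
have H : lift (omit q b) (lo i) <= j < lift (omit q b) (hi i).
  by rewrite hs ht wone_dom.
rewrite (face_one x hs ht H) /P_desc wdesc_one /P_one_map opt_map_optF.
  by rewrite eb.
have [e|[i' [-> e]]] := unlift_case q j.
  by have := congr1 (@nat_of_ord _) e; rewrite /=; lia.
by congr Some; apply: ord_inj; move: e; rewrite /=; lia.
Qed.

(** In [Q_k] only the component [k], from the vertex [k] to [k+1], crosses between the ends: the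
    boolean [k < i] is the end to which the vertex [i] belongs, and in [q_map] the end of a
    component other than [k]. *)
Definition Q_obj_map (k : 'I_n) (i : 'I_n.+1) : E := h (k < i) (wobj C i).

Definition q_map (k : 'I_n) b (i : 'I_n) : qfam K b i -> E :=
  match b return qfam K b i -> E with
  | true => fun y => sval (g i y)
  | false => fun x => h (k < i) (wone x)
  end.

Lemma Q_obj_bd k i a : bd a 0 (Q_obj_map k i) = Q_obj_map k i.
Proof. exact: end_obj_bd. Qed.

Lemma q_map_src k b i (x : qfam K b i) : b = (i == k) ->
  bd false 0 (q_map k x) = Q_obj_map k (lo i).
Proof.
case: b x => x e /=; last by rewrite -fmap_bd wone_src.
rewrite /Q_obj_map -(eqP (esym e)) loE ltnn.
by case: (svalP (g i x)).
Qed.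

Lemma q_map_tgt k b i (x : qfam K b i) : b = (i == k) ->
  bd true 0 (q_map k x) = Q_obj_map k (hi i).
Proof.
rewrite /Q_obj_map hiE; case: b x => x e /=.
  by rewrite -(eqP (esym e)) ltnS leqnn; case: (svalP (g i x)).
rewrite -fmap_bd wone_tgt; congr (h _ _).
have hn : (i : nat) != k by apply/negP => /eqP/ord_inj ei; rewrite ei eqxx in e.
lia.
Qed.

Lemma q_map_bd k b i a d (x : qfam K b i) :
  q_map k (bd a d x) = bd a d.+1 (q_map k x).
Proof. by case: b x => x /=; rewrite ?hom_val_bd // -fmap_bd wone_bd. Qed.

Lemma q_map_comp k b i d (x y : qfam K b i) : composable d x y ->
  q_map k (comp d x y) = comp d.+1 (q_map k x) (q_map k y).
Proof.
case: b x y => x y c /=; first by rewrite hom_val_comp.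
rewrite wone_comp fmap_comp //.
by rewrite /composable -!wone_bd c.
Qed.

Definition Q_desc k : functor (Qcat K k) E :=
  @wdesc _ (fun i => qfam K (i == k) i) _ (Q_obj_map k) (fun i => @q_map k (i == k) i)
    (Q_obj_bd k) (fun i x => q_map_src x erefl) (fun i x => q_map_tgt x erefl)
    (fun i => @q_map_bd k (i == k) i) (fun i => @q_map_comp k (i == k) i).

Lemma Q_desc_cone k (y : K k) :
  Q_desc k (@wone _ (fun i => qfam K (i == k) i) k (qcast (esym (eqxx k)) y)) =
  sval (g k y).
Proof. by rewrite /Q_desc wdesc_one; case: _ / (esym (eqxx k)). Qed.

Lemma Q_desc_qin k b i (x : C i) : Q_desc k (qin K k b (wone x)) =
  if i == k then sval (g i (cyl_in (K i) b x)) else h (k < i) (wone x).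
Proof. by rewrite qin_one /Q_desc wdesc_one; case: (i == k). Qed.

Definition cyl_desc_legs (v : 'I_n.+1 + 'I_n) : functor (@dX (cyl_diag K) v) E :=
  match v with inl q => P_desc q | inr k => Q_desc k end.

(** Only vertices and one-component cells of [T] have to be compared. At the component [k] the
    equation is [g_true] or [g_false]. Elsewhere both sides are values of [h] at the same end;
    beyond the crossing, [face_eq] first exchanges the face for the one on which [P_desc] is
    computed. *)
Lemma cyl_desc_cocone : @is_cocone (cyl_diag K) _ cyl_desc_legs.
Proof.
have neq_val (i k : 'I_n) : i != k -> (i : nat) != k.
  by move=> ne; apply/negP => /eqP/ord_inj ei; rewrite ei eqxx in ne.
case=> k [].
  apply: (@wedge_ext _ _ _ (compF (P_desc (lo k)) (face C (lo k) false))
            (compF (Q_desc k) (qin K k true))) => [i|i x]; rewrite !compFE.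
    rewrite qin_wobj /Q_desc wdesc_obj /Q_obj_map.
    case: (leqP i k) => hik; first by rewrite P_desc_obj.
    by rewrite -face_eq ?P_desc_obj //; [exact: ltnW | left].
  rewrite Q_desc_qin; case: eqP => [e|/eqP/neq_val].
    subst k; rewrite face_split_lo fmap_comp; last exact: face_split_lo_composable.
    by rewrite P_desc_point P_desc_one // g_true.
  case: (ltngtP i k) => // hik _; first by rewrite P_desc_one.
  by rewrite -face_eq ?P_desc_one //; [exact: ltnW | left].
apply: (@wedge_ext _ _ _ (compF (P_desc (hi k)) (face C (hi k) true))
          (compF (Q_desc k) (qin K k false))) => [i|i x]; rewrite !compFE.
  rewrite qin_wobj /Q_desc wdesc_obj /Q_obj_map.
  case: (ltnP k i) => hik; first by rewrite P_desc_obj // hiE.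
  by rewrite face_eq ?P_desc_obj // ?hiE; [exact: leqW | right].
rewrite Q_desc_qin; case: eqP => [e|/eqP/neq_val].
  subst k; rewrite face_split_hi fmap_comp; last exact: face_split_hi_composable.
  by rewrite P_desc_point P_desc_one ?hiE // g_false.
case: (ltngtP i k) => // hik _; last by rewrite P_desc_one // hiE.
by rewrite face_eq ?P_desc_one // ?hiE; [exact: leqW | right; rewrite /= ?hiE].
Qed.

Definition cyl_desc : functor (cyl_step K) E := desc cyl_desc_cocone.

Lemma cyl_desc_P q (X : Pcat C q) : cyl_desc (cyl_P K q X) = P_desc q X.
Proof. exact: (@desc_leg _ _ _ cyl_desc_cocone (inl q) X). Qed.

Lemma cyl_desc_Q k (X : Qcat K k) : cyl_desc (cyl_Q K k X) = Q_desc k X.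
Proof. exact: (@desc_leg _ _ _ cyl_desc_cocone (inr k) X). Qed.

Lemma cyl_desc_arr q : cyl_desc (arr K q) = f q.
Proof. by rewrite cyl_desc_P P_desc_point. Qed.

Lemma cyl_desc_cone k (y : K k) : cyl_desc (cone y) = sval (g k y).
Proof. by rewrite cyl_desc_Q Q_desc_cone. Qed.

Lemma cyl_desc_in e X : cyl_desc (cyl_in (cyl_step K) e X) = h e X.
Proof.
apply: (@wedge_ext _ _ _ (compF cyl_desc (cyl_in (cyl_step K) e)) (h e)) => [i|i x].
  change (cyl_desc (cyl_in (cyl_step K) e (wobj C i)) = h e (wobj C i)).
  rewrite -(@cyl_face_shift e i); last by case: (e).
  by rewrite cyl_desc_P P_desc_obj //; case: (e).
change (cyl_desc (cyl_in (cyl_step K) e (wone x)) = h e (wone x)).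
rewrite -(@cyl_face_shift e (if e then lo i else hi i)); last by case: (e).
by rewrite cyl_desc_P P_desc_one //; case: (e); rewrite ?hiE.
Qed.

End Desc.
End CylinderUniversal.

(** * Whiskering by a 1-cell, and functors from components to homs *)

Section Whiskering.
Variables (E : omegaCat) (x y z : E) (p : E).
Hypothesis p_bd : forall a d, bd a d.+1 p = p.

Lemma whisker_cell_idem d : comp d.+1 p p = p.
Proof. by rewrite -{1}(p_bd false d) comp_idl. Qed.

Section Left.
Hypothesis p_src : bd false 0 p = x.
Hypothesis p_tgt : bd true 0 p = y.
Variables (C : omegaCat) (G : functor C (hom y z)).

Lemma whisker_l_composable c : composable 0 p (sval (G c)).
Proof. by rewrite /composable p_tgt (svalP (G c)).1. Qed.

Let wl c := comp 0 p (sval (G c)).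

Lemma whisker_l_src c : bd false 0 (wl c) = x.
Proof. by rewrite bd_comp_src ?p_src //; apply: whisker_l_composable. Qed.

Lemma whisker_l_tgt c : bd true 0 (wl c) = z.
Proof.
by rewrite bd_comp_tgt ?(svalP (G c)).2 //; apply: whisker_l_composable.
Qed.

Lemma whisker_l_bd a d c : wl (bd a d c) = bd a d.+1 (wl c).
Proof.
by rewrite /wl bd_comp // ?p_bd ?hom_val_bd //; apply: whisker_l_composable.
Qed.

(** The 1-cell [p] is its own composite along dimension [d.+1]; written so, it makes the interchange
    law applicable. *)
Lemma whisker_l_comp d c c' : composable d c c' ->
  wl (comp d c c') = comp d.+1 (wl c) (wl c').
Proof.
move=> h; rewrite /wl -{1}(whisker_cell_idem d) hom_val_comp // interchange //.
- by rewrite /composable !p_bd.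
- by rewrite -!hom_val_bd h.
- by rewrite whisker_cell_idem -hom_val_comp //; apply: whisker_l_composable.
Qed.

Definition whisker_l : functor C (hom x z) :=
  to_hom whisker_l_src whisker_l_tgt whisker_l_bd whisker_l_comp.
End Left.

Section Right.
Hypothesis p_src : bd false 0 p = y.
Hypothesis p_tgt : bd true 0 p = z.
Variables (C : omegaCat) (G : functor C (hom x y)).

Lemma whisker_r_composable c : composable 0 (sval (G c)) p.
Proof. by rewrite /composable p_src (svalP (G c)).2. Qed.

Let wr c := comp 0 (sval (G c)) p.

Lemma whisker_r_src c : bd false 0 (wr c) = x.
Proof.
by rewrite bd_comp_src ?(svalP (G c)).1 //; apply: whisker_r_composable.
Qed.

Lemma whisker_r_tgt c : bd true 0 (wr c) = z.
Proof. by rewrite bd_comp_tgt ?p_tgt //; apply: whisker_r_composable. Qed.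

Lemma whisker_r_bd a d c : wr (bd a d c) = bd a d.+1 (wr c).
Proof.
by rewrite /wr bd_comp // ?p_bd ?hom_val_bd //; apply: whisker_r_composable.
Qed.

Lemma whisker_r_comp d c c' : composable d c c' ->
  wr (comp d c c') = comp d.+1 (wr c) (wr c').
Proof.
move=> h; rewrite /wr -{1}(whisker_cell_idem d) hom_val_comp // interchange //.
- by rewrite -!hom_val_bd h.
- by rewrite !p_bd.
- by rewrite whisker_cell_idem -hom_val_comp //; apply: whisker_r_composable.
Qed.

Definition whisker_r : functor C (hom x z) :=
  to_hom whisker_r_src whisker_r_tgt whisker_r_bd whisker_r_comp.
End Right.
End Whiskering.

Section ComponentFunctors.
Variables (n : nat) (C : 'I_n -> omegaCat) (K : forall i, cylData (C i)).
Variables (E : omegaCat) (k : 'I_n) (x y : E).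

Section Base.
Variable F : functor (wedge C) E.
Hypothesis Fx : F (wobj C (lo k)) = x.
Hypothesis Fy : F (wobj C (hi k)) = y.

Lemma one_hom_src (c : C k) : bd false 0 (F (wone c)) = x.
Proof. by rewrite -fmap_bd. Qed.

Lemma one_hom_tgt (c : C k) : bd true 0 (F (wone c)) = y.
Proof. by rewrite -fmap_bd. Qed.

Lemma one_hom_bd a d (c : C k) : F (wone (bd a d c)) = bd a d.+1 (F (wone c)).
Proof. by rewrite wone_bd fmap_bd. Qed.

Lemma one_hom_comp d (c c' : C k) : composable d c c' ->
  F (wone (comp d c c')) = comp d.+1 (F (wone c)) (F (wone c')).
Proof.
by move=> h; rewrite wone_comp fmap_comp // /composable -!wone_bd h.
Qed.

Definition one_hom : functor (C k) (hom x y) :=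
  to_hom one_hom_src one_hom_tgt one_hom_bd one_hom_comp.
End Base.

Section Cylinder.
Variable F : functor (cyl_step K) E.
Hypothesis Fx : F (cyl_in (cyl_step K) false (wobj C (lo k))) = x.
Hypothesis Fy : F (cyl_in (cyl_step K) true (wobj C (hi k))) = y.

Lemma cone_hom_src (c : K k) : bd false 0 (F (cone c)) = x.
Proof. by rewrite -fmap_bd cone_src. Qed.

Lemma cone_hom_tgt (c : K k) : bd true 0 (F (cone c)) = y.
Proof. by rewrite -fmap_bd cone_tgt. Qed.

Lemma cone_hom_bd a d (c : K k) : F (cone (bd a d c)) = bd a d.+1 (F (cone c)).
Proof. by rewrite cone_bd fmap_bd. Qed.

Lemma cone_hom_comp d (c c' : K k) : composable d c c' ->
  F (cone (comp d c c')) = comp d.+1 (F (cone c)) (F (cone c')).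
Proof.
by move=> h; rewrite cone_comp // fmap_comp // /composable -!cone_bd h.
Qed.

(** The ends [x] and [y] are given up to equations, so that functors whose values on vertices are
    only provably equal land in one and the same hom. *)
Definition cone_hom : functor (K k) (hom x y) :=
  to_hom cone_hom_src cone_hom_tgt cone_hom_bd cone_hom_comp.
End Cylinder.
End ComponentFunctors.

(** * Globular inclusions *)

Section CylMapCells.
Variables (n m p : nat) (H : p + n <= m).
Variables (C : 'I_n -> omegaCat) (D : 'I_m -> omegaCat).
Variables (K : forall i, cylData (C i)) (L : forall j, cylData (D j)).
Variable g : forall i, functor (C i) (D (shift H i)).
Variable G : forall i, functor (K i) (L (shift H i)).
Hypothesis Gg : forall i e x, G i (cyl_in (K i) e x) = cyl_in (L _) e (g i x).

Local Notation sh := (shift (shiftS H)).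

Lemma incl_step_one i (x : C i) : incl_step g (wone x) = wone (g i x).
Proof.
have hs : wsrc (incl_step g (wone x)) = lo (shift H i) by apply: ord_inj.
have ht : wtgt (incl_step g (wone x)) = hi (shift H i).
  by apply: ord_inj; rewrite /= /bump /= addnS.
have h : wsrc (incl_step g (wone x)) <= shift H i < wtgt (incl_step g (wone x)).
  by rewrite hs ht wone_dom.
rewrite (woneP hs ht h); congr wone.
by rewrite (@incl_step_val _ _ _ _ _ _ g _ _ h (wone_dom i)) wone_val.
Qed.

Lemma cyl_map_P q (X : Pcat C q) :
  cyl_map Gg (cyl_P K q X) = cyl_P L (sh q) (shiftP g q X).
Proof. exact: (@desc_leg _ _ _ (cyl_map_cocone Gg) (inl q) X). Qed.

Lemma cyl_map_Q k (X : Qcat K k) :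
  cyl_map Gg (cyl_Q K k X) = cyl_Q L (shift H k) (shiftQ g G k X).
Proof. exact: (@desc_leg _ _ _ (cyl_map_cocone Gg) (inr k) X). Qed.

Lemma cyl_map_arr q : cyl_map Gg (arr K q) = arr L (sh q).
Proof.
rewrite cyl_map_P /arr; congr (fmap _ _).
set X := (X in X = _).
have hs : wsrc X = lo (sh q) by apply: ord_inj.
have ht : wtgt X = hi (sh q) by apply: ord_inj; rewrite /= /bump /= addnS.
have h : wsrc X <= sh q < wtgt X by rewrite hs ht wone_dom.
rewrite (woneP hs ht h); congr wone; exact: optfam_diag.
Qed.

Lemma cyl_map_cone k (y : K k) : cyl_map Gg (cone y) = cone (G k y).
Proof.
rewrite cyl_map_Q /cone; congr (fmap _ _).
set x := qcast _ y; set X := (X in X = _).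
have hs : wsrc X = lo (shift H k) by apply: ord_inj.
have ht : wtgt X = hi (shift H k) by apply: ord_inj; rewrite /= /bump /= addnS.
have h : wsrc X <= shift H k < wtgt X by rewrite hs ht wone_dom.
rewrite (woneP hs ht h); congr wone; subst X.
have -> : wval h = castF (D := fun b => qfam L b (shift H k)) (shift_eq H k k)
                     (qmap g G (k == k) k) x.
  rewrite -[in RHS](@wone_val _ (fun i => qfam K (i == k) i) k x (wone_dom k)).
  exact: (@emb_val n m (fun i => qfam K (i == k) i)
            (fun j => qfam L (j == shift H k) j) sh (shift H) p
            (fun=> erefl) (fun=> erefl)
            (fun i => castF (D := fun b => qfam L b (shift H i)) (shift_eq H i k)
                        (qmap g G (i == k) i))).
(* Generalising the tests [k == k] and [shift H k == shift H k] to variables lets the three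
   transports be eliminated. *)
have key b b' (e : b' = b) (h1 : true = b) (h2 : true = b') :
    castF (D := fun b => qfam L b (shift H k)) e (qmap g G b k) (qcast h1 y) =
    qcast h2 (G k y).
  by subst b'; case: _ / h1 h2 => h2; rewrite (Prop_irrelevance h2 erefl).
exact: key.
Qed.

End CylMapCells.

Section InclusionParts.
Variables (n m : nat) (A : 'I_n -> theta) (B : 'I_m -> theta).
Variable u : incl (Cell A) (Cell B).

Definition incl_bound : projT1 u + n <= m := projT1 (projT2 u).

Definition incl_vertex (i : 'I_n.+1) : 'I_m.+1 := shift (shiftS incl_bound) i.

Definition incl_index (i : 'I_n) : 'I_m := shift incl_bound i.

Definition incl_part (i : 'I_n) : incl (A i) (B (incl_index i)) :=
  projT2 (projT2 u) i.

Lemma incl_vertex_lo i : incl_vertex (lo i) = lo (incl_index i).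
Proof. exact: ord_inj. Qed.

Lemma incl_vertex_hi i : incl_vertex (hi i) = hi (incl_index i).
Proof. by apply: ord_inj; rewrite /= /bump /= addnS. Qed.

Lemma incl_index_eq (i : 'I_n) (k : 'I_m) :
  incl_vertex (lo i) = lo k -> incl_index i = k.
Proof. by move=> e; apply: ord_inj; have := congr1 (@nat_of_ord _) e. Qed.

End InclusionParts.

Section InclusionPartsTheory.
Variables (n m : nat) (A : 'I_n -> theta) (B : 'I_m -> theta).
Variable u : incl (Cell A) (Cell B).

Lemma real_incl_src (X : real (Cell A)) :
  wsrc (real_incl u X : real (Cell B)) = incl_vertex u (wsrc X).
Proof. by case: u => p [H g]. Qed.

Lemma real_incl_tgt (X : real (Cell A)) :
  wtgt (real_incl u X : real (Cell B)) = incl_vertex u (wtgt X).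
Proof. by case: u => p [H g]. Qed.

Lemma real_incl_obj i :
  real_incl u (wobj _ i : real (Cell A)) = wobj _ (incl_vertex u i).
Proof.
apply: wcell_eq; [exact: real_incl_src | exact: real_incl_tgt |].
by move=> j h h'; exfalso; move: h'; rewrite /=; lia.
Qed.

Lemma real_incl_one i (x : real (A i)) :
  real_incl u (wone x : real (Cell A)) = wone (real_incl (incl_part u i) x).
Proof. by case: u => p [H g]; apply: incl_step_one. Qed.

Lemma cyl_incl_arr q :
  cyl_incl u (arr (fun i => cyl (A i)) q) =
  arr (fun i => cyl (B i)) (incl_vertex u q).
Proof. by case: u => p [H g]; apply: cyl_map_arr. Qed.

Lemma cyl_incl_cone i (y : cyl (A i)) :
  cyl_incl u (cone (K := fun i => cyl (A i)) y) =
  cone (K := fun i => cyl (B i)) (cyl_incl (incl_part u i) y).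
Proof. by case: u => p [H g]; apply: cyl_map_cone. Qed.

End InclusionPartsTheory.

Lemma cyl_incl_in (S T : theta) (u : incl S T) e x :
  cyl_incl u (cyl_in (cyl S) e x) = cyl_in (cyl T) e (real_incl u x).
Proof. exact: (svalP (cyl_incl_sig u)). Qed.

Definition incl_cast (S : theta) n (A : 'I_n -> theta) (i k : 'I_n) (e : i = k)
    (g : incl S (A i)) : incl S (A k) :=
  eq_rect i (fun i => incl S (A i)) g k e.

Lemma wone_cast S n (A : 'I_n -> theta) (i k : 'I_n) (e : i = k)
    (g : incl S (A i)) x :
  wone (C := fun i => real (A i)) (real_incl (incl_cast e g) x) =
  wone (C := fun i => real (A i)) (real_incl g x).
Proof. by case: _ / e. Qed.

Lemma cone_cast S n (A : 'I_n -> theta) (i k : 'I_n) (e : i = k)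
    (g : incl S (A i)) y :
  cone (K := fun i => cyl (A i)) (cyl_incl (incl_cast e g) y) =
  cone (K := fun i => cyl (A i)) (cyl_incl g y).
Proof. by case: _ / e. Qed.

(** Inclusions are data and are not composed here; this lemma takes the place of functoriality and
    makes the cylinders into a cocone. By induction on [R]: the vertex equation [ev] identifies the
    two target indices of a cone, and injectivity of [wone] passes the hypothesis on to the
    components. *)
Lemma cyl_incl_agree (R S S' T : theta) (u : incl R S) (v : incl R S')
    (w : incl S T) (w' : incl S' T) :
  (forall x, real_incl w (real_incl u x) = real_incl w' (real_incl v x)) ->
  forall y, cyl_incl w (cyl_incl u y) = cyl_incl w' (cyl_incl v y).
Proof.
elim: R S S' T u v w w' => r AR IH [s AS] [s' AS'] [t AT] u v w w' e.
have ev q : incl_vertex w (incl_vertex u q) = incl_vertex w' (incl_vertex v q).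
  have := congr1 (fun X : real (Cell AT) => wsrc X) (e (wobj _ q)).
  by rewrite !real_incl_obj.
apply: (@cyl_ext _ _ (fun i => cyl (AR i)) _
          (compF (cyl_incl w) (cyl_incl u)) (compF (cyl_incl w') (cyl_incl v))).
- by move=> b X; rewrite !compFE !(@cyl_incl_in (Cell _)) e.
- by move=> q; rewrite !compFE !cyl_incl_arr ev.
move=> k y; rewrite !compFE !cyl_incl_cone.
have ek : incl_index w (incl_index u k) = incl_index w' (incl_index v k).
  by apply: incl_index_eq; rewrite -!incl_vertex_lo ev.
rewrite -(cone_cast ek); congr (cone _).
apply: IH => x; apply: (@wone_inj _ (fun i => real (AT i))).
rewrite wone_cast; have := e (wone x).
by rewrite !real_incl_one.
Qed.

(** * Colimits along globular inclusions *)

Definition susp (E : omegaCat) : omegaCat := wedge (fun _ : 'I_1 => E).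

Section Collapse.
Variables (n N : nat) (C : 'I_n -> omegaCat) (E : omegaCat) (k : 'I_N).
Variables (vtx : 'I_n.+1 -> 'I_N.+1) (idx : 'I_n -> 'I_N).
Hypothesis vtx_lo : forall i, vtx (lo i) = lo (idx i).
Hypothesis vtx_hi : forall i, vtx (hi i) = hi (idx i).
Variable c : forall i, idx i = k -> functor (C i) E.

(** With its vertices separated in this way, a functor to [susp E] has freedom only on the component
    [k]: every other component joins two vertices with the same image, whose hom has a single
    cell. *)
Definition side (x : 'I_N.+1) : susp E :=
  wobj (fun _ : 'I_1 => E) (if k < x then ord_max else ord0).

Definition collapse_one i (x : C i) : susp E :=
  match @eqP _ (idx i) k with
  | ReflectT e => wone (C := fun _ : 'I_1 => E) (k := ord0) (c e x)
  | ReflectF _ => side (vtx (lo i))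
  end.

Lemma collapse_one_in i (x : C i) (e : idx i = k) :
  collapse_one x = wone (C := fun _ : 'I_1 => E) (k := ord0) (c e x).
Proof.
rewrite /collapse_one; case: {-}_ / eqP => // e'.
by rewrite (Prop_irrelevance e e').
Qed.

Lemma collapse_one_out i (x : C i) : idx i <> k ->
  collapse_one x = side (vtx (lo i)).
Proof. by rewrite /collapse_one; case: {-}_ / eqP. Qed.

Lemma side_bd x a d : bd a d (side x) = side x.
Proof. by apply: (@bd_fix _ a _ _ 0) => //; case: a. Qed.

Lemma collapse_one_src i (x : C i) : bd false 0 (collapse_one x) = side (vtx (lo i)).
Proof.
case: (pselect (idx i = k)) => e; last by rewrite collapse_one_out ?side_bd.
rewrite (collapse_one_in x e) wone_src /side vtx_lo e loE ltnn.
by congr wobj; apply: ord_inj.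
Qed.

Lemma collapse_one_tgt i (x : C i) : bd true 0 (collapse_one x) = side (vtx (hi i)).
Proof.
case: (pselect (idx i = k)) => e.
  rewrite (collapse_one_in x e) wone_tgt /side vtx_hi e hiE leqnn.
  by congr wobj; apply: ord_inj.
rewrite collapse_one_out // side_bd /side vtx_lo vtx_hi hiE loE ltnS.
have hn : (idx i : nat) != k by apply/negP => /eqP/ord_inj.
by congr wobj; case: (ltngtP k (idx i)) hn.
Qed.

Lemma collapse_one_bd i a d (x : C i) :
  collapse_one (bd a d x) = bd a d.+1 (collapse_one x).
Proof.
case: (pselect (idx i = k)) => e; last by rewrite !collapse_one_out ?side_bd.
by rewrite !(collapse_one_in _ e) fmap_bd wone_bd.
Qed.

Lemma collapse_one_comp i d (x y : C i) : composable d x y ->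
  collapse_one (comp d x y) = comp d.+1 (collapse_one x) (collapse_one y).
Proof.
move=> h; case: (pselect (idx i = k)) => e.
  by rewrite !(collapse_one_in _ e) fmap_comp // wone_comp.
by rewrite !collapse_one_out // -{2}(side_bd _ false d.+1) comp_idl.
Qed.

(** The components that do not lie over [k] are sent to identities. *)
Definition collapse : functor (wedge C) (susp E) :=
  @wdesc _ _ _ (fun x => side (vtx x)) collapse_one
    (fun i a => side_bd (vtx i) a 0)
    collapse_one_src collapse_one_tgt collapse_one_bd collapse_one_comp.

Lemma collapse_obj x : collapse (wobj _ x) = side (vtx x).
Proof. exact: wdesc_obj. Qed.

Lemma collapse_in i (e : idx i = k) (x : C i) :
  collapse (wone x) = wone (C := fun _ : 'I_1 => E) (k := ord0) (c e x).
Proof. by rewrite /collapse wdesc_one (collapse_one_in x e). Qed.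

Lemma collapse_out i (x : C i) : idx i <> k ->
  collapse (wone x) = side (vtx (lo i)).
Proof. by move=> e; rewrite /collapse wdesc_one collapse_one_out. Qed.

End Collapse.

Section SuspComponent.
Variables (n : nat) (C : 'I_n -> omegaCat) (E : omegaCat) (k : 'I_n).
Variable F : functor (wedge C) (susp E).
Hypothesis F_obj : forall x, F (wobj C x) = side E k x.

Lemma susp_src (x : C k) : wsrc (F (wone x)) = ord0.
Proof.
have := congr1 (fun X : susp E => wsrc X) (fmap_bd F false 0 (wone x)).
by rewrite wone_src F_obj /side loE ltnn => <-.
Qed.

Lemma susp_tgt (x : C k) : wtgt (F (wone x)) = ord_max.
Proof.
have := congr1 (fun X : susp E => wsrc X) (fmap_bd F true 0 (wone x)).
by rewrite wone_tgt F_obj /side hiE leqnn => /= <-.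
Qed.

Lemma susp_dom (x : C k) : wsrc (F (wone x)) <= (ord0 : 'I_1) < wtgt (F (wone x)).
Proof. by rewrite susp_src susp_tgt. Qed.

Let comp_fun (x : C k) : E := wval (susp_dom x).

Lemma susp_component_bd a d x : comp_fun (bd a d x) = bd a d (comp_fun x).
Proof.
have e : F (wone (bd a d x)) = bd a d.+1 (F (wone x)) by rewrite wone_bd fmap_bd.
exact: (wval_eq e _ (susp_dom x)).
Qed.

Lemma susp_component_comp d x y : composable d x y ->
  comp_fun (comp d x y) = comp d (comp_fun x) (comp_fun y).
Proof.
move=> c; have e : F (wone (comp d x y)) = comp d.+1 (F (wone x)) (F (wone y)).
  by rewrite wone_comp fmap_comp // /composable -!wone_bd c.
rewrite /comp_fun (wval_eq e _ (susp_dom x)).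
exact: wcompS_val.
Qed.

(** The converse of [collapse]: by [F_obj], the cells of the component [k] are sent to cells from 0
    to 1, which consist of one entry in [E]. *)
Definition susp_component : functor (C k) E :=
  Functor susp_component_bd susp_component_comp.

Lemma susp_componentE x y :
  F (wone x) = wone (C := fun _ : 'I_1 => E) (k := ord0) y -> susp_component x = y.
Proof.
move=> e; rewrite -[y](@wone_val _ (fun _ : 'I_1 => E) ord0 y (wone_dom ord0)).
exact: (wval_eq e _ (wone_dom ord0)).
Qed.

End SuspComponent.

Section Diagrams.
Variables (I J : Type) (S : I -> theta) (R : J -> theta) (dl dr : J -> I).
Variable u : forall j, incl (R j) (S (dl j)).
Variable v : forall j, incl (R j) (S (dr j)).

Definition real_diag : spanDiagram :=
  @SpanDiagram I J (fun i => real (S i)) (fun j => real (R j)) dl dr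
    (fun j => real_incl (u j)) (fun j => real_incl (v j)).

Definition cylinder_diag : spanDiagram :=
  @SpanDiagram I J (fun i => cyl (S i)) (fun j => cyl (R j)) dl dr
    (fun j => cyl_incl (u j)) (fun j => cyl_incl (v j)).

Definition cyl_preserved (T : theta) : Prop :=
  forall iota : forall i, incl (S i) T,
  @is_colimit real_diag (real T) (fun i => real_incl (iota i)) ->
  @is_colimit cylinder_diag (cyl T) (fun i => cyl_incl (iota i)).

End Diagrams.

(** * The inductive step: colimits with vertex [[N];(A_1,...,A_N)] *)

Section Step.
Variables (I J : Type) (nS : I -> nat) (AS : forall i, 'I_(nS i) -> theta).
Variables (nR : J -> nat) (AR : forall j, 'I_(nR j) -> theta) (dl dr : J -> I).
Variable u : forall j, incl (Cell (@AR j)) (Cell (@AS (dl j))).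
Variable v : forall j, incl (Cell (@AR j)) (Cell (@AS (dr j))).
Variables (N : nat) (A : 'I_N -> theta).
Variable iota : forall i, incl (Cell (@AS i)) (Cell A).

Local Notation RD := (@real_diag I J (fun i => Cell (@AS i))
  (fun j => Cell (@AR j)) dl dr u v).
Local Notation CD := (@cylinder_diag I J (fun i => Cell (@AS i))
  (fun j => Cell (@AR j)) dl dr u v).

Hypothesis hT : @is_colimit RD (real (Cell A)) (fun i => real_incl (iota i)).

Let hcocone j (y : real (Cell (@AR j))) :
  real_incl (iota (dl j)) (real_incl (u j) y) =
  real_incl (iota (dr j)) (real_incl (v j) y).
Proof. by case: hT => h _ _; apply: h. Qed.

Let hext (E : omegaCat) (h h' : functor (real (Cell A)) E) :
  (forall i x, h (real_incl (iota i) x) = h' (real_incl (iota i) x)) -> h =1 h'.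
Proof. by case: hT => _ _ H hh; apply: H => i x; apply: hh. Qed.

Let hdesc (E : omegaCat) (c : forall i, functor (real (Cell (@AS i))) E) :
  (forall j y, c (dl j) (real_incl (u j) y) = c (dr j) (real_incl (v j) y)) ->
  exists h : functor (real (Cell A)) E, forall i x, h (real_incl (iota i) x) = c i x.
Proof. by case: hT => _ H _ hc; apply: (H E c). Qed.

Lemma vertex_cocone j q : incl_vertex (iota (dl j)) (incl_vertex (u j) q) =
  incl_vertex (iota (dr j)) (incl_vertex (v j) q).
Proof.
have := congr1 (fun X : real (Cell A) => wsrc X) (hcocone (wobj _ q)).
by rewrite !real_incl_obj.
Qed.

Lemma index_cocone j b : incl_index (iota (dl j)) (incl_index (u j) b) =
  incl_index (iota (dr j)) (incl_index (v j) b).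
Proof. by apply: incl_index_eq; rewrite -!incl_vertex_lo vertex_cocone. Qed.

(** Here [S] may be the type of all cells of an omega-category: equations between cells indexed by
    the vertices of [T], such as the boundaries of the arrows, are thus checked on the [S_i]. *)
Lemma vertex_ext (S : Type) (f g : 'I_N.+1 -> S) :
  (forall i x, f (incl_vertex (iota i) x) = g (incl_vertex (iota i) x)) -> f =1 g.
Proof.
move=> e x; pose F f0 := to_codisc (fun i => real (A i)) (f0 : 'I_N.+1 -> S).
have h : F f =1 F g.
  apply: (@hext (codisc S) (F f) (F g)) => i X.
  by congr pair; rewrite ?real_incl_src ?real_incl_tgt e.
exact: (congr1 fst (h (wobj _ x))).
Qed.

Lemma vertex_desc (S : Type) (f : forall i, 'I_(nS i).+1 -> S) :
  (forall j q, f (dl j) (incl_vertex (u j) q) = f (dr j) (incl_vertex (v j) q)) ->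
  exists g : 'I_N.+1 -> S, forall i x, g (incl_vertex (iota i) x) = f i x.
Proof.
move=> e; have [|h he] := @hdesc (codisc S) (fun i => to_codisc _ (f i)).
  by move=> j y; rewrite /= !real_incl_src !real_incl_tgt !e.
exists (fun x => (h (wobj _ x)).1) => i x.
by have := congr1 fst (he i (wobj _ x)); rewrite real_incl_obj.
Qed.

Section Component.
Variable k : 'I_N.

(** The components of the [S i] that are sent to the component [k] of [T]. *)
Record slot := Slot {
  slot_obj : I;
  slot_idx : 'I_(nS slot_obj);
  slot_over : incl_index (iota slot_obj) slot_idx = k
}.

(** The condition is imposed on the left leg only; [index_cocone] transfers it to the right leg in
    [slot_r]. *)
Record span_slot := SpanSlot {
  span_obj : J;
  span_idx : 'I_(nR span_obj);
  span_over :
    incl_index (iota (dl span_obj)) (incl_index (u span_obj) span_idx) = k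
}.

Definition slot_cell (z : slot) : theta := AS (slot_idx z).
Definition span_cell (w : span_slot) : theta := AR (span_idx w).
Definition slot_l (w : span_slot) : slot := Slot (span_over w).
Definition slot_r (w : span_slot) : slot :=
  Slot (etrans (esym (index_cocone (span_idx w))) (span_over w)).
Definition slot_u (w : span_slot) : incl (span_cell w) (slot_cell (slot_l w)) :=
  incl_part (u (span_obj w)) (span_idx w).
Definition slot_v (w : span_slot) : incl (span_cell w) (slot_cell (slot_r w)) :=
  incl_part (v (span_obj w)) (span_idx w).
Definition slot_incl (z : slot) : incl (slot_cell z) (A k) :=
  incl_cast (slot_over z) (incl_part (iota (slot_obj z)) (slot_idx z)).

Lemma slot_incl_one (z : slot) (x : real (slot_cell z)) :
  wone (C := fun i => real (A i)) (real_incl (slot_incl z) x) =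
  real_incl (iota (slot_obj z)) (wone x : real (Cell (@AS (slot_obj z)))).
Proof. by rewrite wone_cast real_incl_one. Qed.

Lemma slot_incl_cone (z : slot) (y : cyl (slot_cell z)) :
  cone (K := fun i => cyl (A i)) (cyl_incl (slot_incl z) y) =
  cyl_incl (iota (slot_obj z)) (cone (K := fun i => cyl (AS i)) y).
Proof. by rewrite cone_cast cyl_incl_cone. Qed.

(** Two functors out of [A k] extend to functors from [T] to the suspension of
    [E], which agree on the components that do not lie over [k]. *)
Lemma slot_ext (E : omegaCat) (G G' : functor (real (A k)) E) :
  (forall z x, G (real_incl (slot_incl z) x) = G' (real_incl (slot_incl z) x)) ->
  G =1 G'.
Proof.
move=> e y.
pose c (G : functor (real (A k)) E) i (ei : i = k) : functor (real (A i)) E :=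
  match esym ei in _ = i return functor (real (A i)) E with erefl => G end.
pose F G := @collapse N N (fun i => real (A i)) E k id id
  (fun=> erefl) (fun=> erefl) (c G).
have FG G0 x : F G0 (wone x) = wone (C := fun _ : 'I_1 => E) (k := ord0) (G0 x).
  exact: (@collapse_in _ _ _ _ _ _ _ _ _ _ _ erefl).
apply: (@wone_inj _ (fun _ : 'I_1 => E) ord0); rewrite -!FG.
apply: hext => i.
apply: (@wedge_ext _ _ _ (compF (F G) (real_incl (iota i)))
          (compF (F G') (real_incl (iota i)))) => [x|a x]; rewrite !compFE.
  by rewrite real_incl_obj /F !collapse_obj.
case: (pselect (incl_index (iota i) a = k)) => ek.
  by rewrite -(@slot_incl_one (Slot ek)) !FG e.
by rewrite real_incl_one /F !collapse_out.
Qed.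

(** The functors [c] collapse each [S_i] to [susp E], compatibly with the spans. The resulting
    functor out of [T] acts on vertices as [side] does, since this holds on the [S_i]; its component
    at [k] is the functor wanted. *)
Lemma slot_desc (E : omegaCat) (c : forall z, functor (real (slot_cell z)) E) :
  (forall w y, c (slot_l w) (real_incl (slot_u w) y) =
               c (slot_r w) (real_incl (slot_v w) y)) ->
  exists G : functor (real (A k)) E,
    forall z x, G (real_incl (slot_incl z) x) = c z x.
Proof.
move=> hc.
pose F i := @collapse _ _ (fun a => real (AS a)) E k _ _
  (incl_vertex_lo (iota i)) (incl_vertex_hi (iota i)) (fun a e => c (Slot e)).
have [j|h he] := @hdesc _ F.
  apply: (@wedge_ext _ _ _ (compF (F (dl j)) (real_incl (u j)))
            (compF (F (dr j)) (real_incl (v j)))) => [x|b x]; rewrite !compFE.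
    by rewrite !real_incl_obj /F !collapse_obj vertex_cocone.
  rewrite !real_incl_one /F.
  case: (pselect (incl_index (iota (dl j)) (incl_index (u j) b) = k)) => e.
    have e' := etrans (esym (index_cocone b)) e.
    rewrite (collapse_in _ _ _ e) (collapse_in _ _ _ e'); congr wone.
    have := hc (SpanSlot e) x; rewrite /slot_l /slot_r /=.
    by rewrite (Prop_irrelevance (etrans _ _) e').
  rewrite !collapse_out -?index_cocone //.
  by rewrite !incl_vertex_lo index_cocone.
have hobj x : h (wobj (fun i => real (A i)) x) = side E k x.
  by move: x; apply: vertex_ext => i x; rewrite -real_incl_obj he /F collapse_obj.
exists (susp_component hobj) => z x; apply: susp_componentE.
rewrite slot_incl_one he /F (collapse_in _ _ _ (slot_over z)).
by case: z x.
Qed.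

Lemma slot_colimit :
  @is_colimit (real_diag slot_u slot_v)
    (real (A k)) (fun z => real_incl (slot_incl z)).
Proof.
split.
- move=> w y; apply: (@wone_inj _ (fun i => real (A i)) k).
  rewrite [LHS](@slot_incl_one (slot_l w)) [RHS](@slot_incl_one (slot_r w)).
  have := hcocone (wone y : real (Cell (@AR (span_obj w)))).
  by rewrite !real_incl_one.
- move=> E c hc; have [G hG] := slot_desc hc.
  by exists G => z x; apply: hG.
- by move=> E G G' h; apply: slot_ext => z x; apply: h.
Qed.

End Component.
Hypothesis IH : forall k (I' J' : Type) (S' : I' -> theta) (R' : J' -> theta)
  (dl' dr' : J' -> I') (u' : forall j, incl (R' j) (S' (dl' j)))
  (v' : forall j, incl (R' j) (S' (dr' j))), cyl_preserved u' v' (A k).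

Let slot_cyl_colimit k :
  @is_colimit (cylinder_diag (@slot_u k) (@slot_v k)) (cyl (A k))
    (fun z => cyl_incl (@slot_incl k z)).
Proof. by apply: IH; apply: slot_colimit. Qed.

Lemma slot_cyl_ext k (E : omegaCat) (G G' : functor (cyl (A k)) E) :
  (forall (z : slot k) y,
     G (cyl_incl (slot_incl z) y) = G' (cyl_incl (slot_incl z) y)) -> G =1 G'.
Proof.
by case: (slot_cyl_colimit k) => _ _ H h; apply: H => z y; apply: h.
Qed.

Lemma slot_cyl_desc k (E : omegaCat)
    (c : forall z : slot k, functor (cyl (slot_cell z)) E) :
  (forall w y, c (slot_l w) (cyl_incl (slot_u w) y) =
               c (slot_r w) (cyl_incl (slot_v w) y)) ->
  exists G : functor (cyl (A k)) E,
    forall z y, G (cyl_incl (slot_incl z) y) = c z y.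
Proof. by case: (slot_cyl_colimit k) => _ H _ hc; apply: (H E c). Qed.

Local Notation KA := (fun i => cyl (A i)).
Local Notation cylT := (cyl (Cell A)).
Local Notation cylS i := (cyl (Cell (@AS i))).
Local Notation KS i := (fun a => cyl (@AS i a)).

Lemma cyl_incl_ext (E : omegaCat) (h h' : functor cylT E) :
  (forall i x, h (cyl_incl (iota i) x) = h' (cyl_incl (iota i) x)) -> h =1 h'.
Proof.
move=> e; have ein b : compF h (cyl_in cylT b) =1 compF h' (cyl_in cylT b).
  by apply: hext => i x; rewrite !compFE -cyl_incl_in e.
apply: (@cyl_ext _ _ KA) => [b x|q|k y]; first exact: ein.
  by move: q; apply: vertex_ext => i q; rewrite -cyl_incl_arr e.
pose F := @cone_hom _ _ KA _ k _ _ h erefl erefl.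
(* The ends of [h'] are replaced by those of [h], so that [F] and [F'] have the same codomain. *)
pose F' := @cone_hom _ _ KA _ k _ _ h' (esym (ein _ _)) (esym (ein _ _)).
have FF : F =1 F'.
  apply: slot_cyl_ext => z x; apply: hom_eq.
  change (h (cone (K := KA) (cyl_incl (slot_incl z) x)) =
          h' (cone (K := KA) (cyl_incl (slot_incl z) x))).
  by rewrite slot_incl_cone e.
exact: (congr1 sval (FF y)).
Qed.

Section Existence.
Variables (E : omegaCat) (c : forall i, functor (cylS i) E).
Hypothesis hc : forall j y,
  c (dl j) (cyl_incl (u j) y) = c (dr j) (cyl_incl (v j) y).
Variable h : bool -> functor (real (Cell A)) E.
Hypothesis hh : forall b i x,
  h b (real_incl (iota i) x) = c i (cyl_in (cylS i) b x).
Variable f : 'I_N.+1 -> E.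
Hypothesis hf : forall i q,
  f (incl_vertex (iota i) q) = c i (arr (KS i) q).

Lemma end_vertex b i q : h b (wobj _ (incl_vertex (iota i) q)) =
  c i (cyl_in (cylS i) b (wobj _ q)).
Proof. by rewrite -hh real_incl_obj. Qed.

Lemma arrow_src q : bd false 0 (f q) = h false (wobj _ q).
Proof.
by move: q; apply: vertex_ext => i q; rewrite hf end_vertex -fmap_bd arr_src.
Qed.

Lemma arrow_tgt q : bd true 0 (f q) = h true (wobj _ q).
Proof.
by move: q; apply: vertex_ext => i q; rewrite hf end_vertex -fmap_bd arr_tgt.
Qed.

Lemma arrow_bd q a d : bd a d.+1 (f q) = f q.
Proof.
by move: q; apply: vertex_ext => i q; rewrite hf -fmap_bd arr_bd.
Qed.

Section AtSlot.
Variables (k : 'I_N) (z : slot k).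

Lemma slot_end_lo b :
  c (slot_obj z) (cyl_in (cylS _) b (wobj _ (lo (slot_idx z)))) =
  h b (wobj _ (lo k)).
Proof. by rewrite -end_vertex incl_vertex_lo slot_over. Qed.

Lemma slot_end_hi b :
  c (slot_obj z) (cyl_in (cylS _) b (wobj _ (hi (slot_idx z)))) =
  h b (wobj _ (hi k)).
Proof. by rewrite -end_vertex incl_vertex_hi slot_over. Qed.

Lemma slot_arrow_lo : c (slot_obj z) (arr (KS _) (lo (slot_idx z))) = f (lo k).
Proof. by rewrite -hf incl_vertex_lo slot_over. Qed.

Lemma slot_arrow_hi : c (slot_obj z) (arr (KS _) (hi (slot_idx z))) = f (hi k).
Proof. by rewrite -hf incl_vertex_hi slot_over. Qed.

Lemma slot_end_one b x :
  h b (wone (C := fun i => real (A i)) (real_incl (slot_incl z) x)) =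
  c (slot_obj z) (cyl_in (cylS _) b (wone x)).
Proof. by rewrite slot_incl_one hh. Qed.

Definition slot_hom :
    functor (cyl (slot_cell z))
      (hom (h false (wobj _ (lo k))) (h true (wobj _ (hi k)))) :=
  @cone_hom _ _ (KS _) _ _ _ _ (c (slot_obj z))
    (slot_end_lo false) (slot_end_hi true).

End AtSlot.

Lemma component_desc k : exists
  G : functor (cyl (A k))
        (hom (h false (wobj _ (lo k))) (h true (wobj _ (hi k)))),
  forall z y, G (cyl_incl (slot_incl z) y) = slot_hom z y.
Proof.
apply: slot_cyl_desc => w y; apply: hom_eq.
have := hc (cone (K := fun b => cyl (@AR (span_obj w) b)) y).
by rewrite !cyl_incl_cone.
Qed.

Lemma cyl_glue_desc : exists F : functor cylT E,
  forall i x, F (cyl_incl (iota i) x) = c i x.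
Proof.
pose g k := sval (cid (component_desc k)).
have gE k (z : slot k) y : sval (g k (cyl_incl (slot_incl z) y)) =
    c (slot_obj z) (cone (K := KS _) y).
  by rewrite /g; case: cid => G /= ->.
(* Both sides are functors from [A_k] to one hom, the right one by whiskering; so [slot_ext] reduces
   the equation to the slots, where it is the image under [c] of [cone_in_true] for the [S_i]. *)
have g_true k x : sval (g k (cyl_in (cyl (A k)) true x)) =
    comp 0 (f (lo k)) (h true (wone x)).
  pose W := @whisker_l _ _ _ _ _ (arrow_bd (lo k)) (arrow_src _) (arrow_tgt _) _
    (@one_hom _ _ _ k _ _ (h true) erefl erefl).
  have e : compF (g k) (cyl_in (cyl (A k)) true) =1 W.
    apply: slot_ext => z y; apply: hom_eq.
    rewrite compFE -cyl_incl_in gE.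
    change (c (slot_obj z) (cone (K := KS _) (cyl_in (cyl (slot_cell z)) true y)) =
      comp 0 (f (lo k)) (h true (wone (real_incl (slot_incl z) y)))).
    rewrite (@cone_in_true _ _ (KS _)) fmap_comp ?slot_arrow_lo ?slot_end_one //.
    by rewrite /composable arr_tgt -fmap_bd.
  exact: (congr1 sval (e x)).
have g_false k x : sval (g k (cyl_in (cyl (A k)) false x)) =
    comp 0 (h false (wone x)) (f (hi k)).
  pose W := @whisker_r _ _ _ _ _ (arrow_bd (hi k)) (arrow_src _) (arrow_tgt _) _
    (@one_hom _ _ _ k _ _ (h false) erefl erefl).
  have e : compF (g k) (cyl_in (cyl (A k)) false) =1 W.
    apply: slot_ext => z y; apply: hom_eq.
    rewrite compFE -cyl_incl_in gE.
    change (c (slot_obj z) (cone (K := KS _) (cyl_in (cyl (slot_cell z)) false y)) =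
      comp 0 (h false (wone (real_incl (slot_incl z) y))) (f (hi k))).
    rewrite (@cone_in_false _ _ (KS _)) fmap_comp ?slot_arrow_hi ?slot_end_one //.
    by rewrite /composable arr_src -fmap_bd.
  exact: (congr1 sval (e x)).
pose F := @cyl_desc _ _ KA E h f g arrow_src arrow_tgt arrow_bd g_true g_false.
exists F => i; apply: (@cyl_ext _ _ (KS i) _ (compF F (cyl_incl (iota i)))).
- by move=> b x; rewrite compFE (@cyl_incl_in (Cell _)) cyl_desc_in hh.
- by move=> q; rewrite compFE cyl_incl_arr cyl_desc_arr hf.
(* Every component of [S_i] is a slot over its own image in [T]. *)
move=> a y; rewrite compFE -(@slot_incl_cone _ (Slot erefl)) cyl_desc_cone.
exact: gE.
Qed.

End Existence.

Lemma cyl_step_colimit : @is_colimit CD cylT (fun i => cyl_incl (iota i)).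
Proof.
split.
- by move=> j; apply: cyl_incl_agree; apply: hcocone.
- move=> E c hc.
  have hex b : exists h : functor (real (Cell A)) E,
      forall i x, h (real_incl (iota i) x) = c i (cyl_in (cylS i) b x).
    apply: (hdesc (c := fun i => compF (c i) (cyl_in (cylS i) b))) => j y.
    by rewrite !compFE -!cyl_incl_in; apply: hc.
  have [f hf] : exists f : 'I_N.+1 -> E, forall i q,
      f (incl_vertex (iota i) q) = c i (arr (KS i) q).
    by apply: vertex_desc => j q; rewrite -!cyl_incl_arr; apply: hc.
  have [F hF] := cyl_glue_desc hc (fun b => svalP (cid (hex b))) hf.
  by exists F => i x; apply: hF.
- by move=> E F F' e; apply: cyl_incl_ext => i x; apply: (e i x).
Qed.

End Step.

(** * Induction on the cell, and the comparison map *)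

Definition arity (T : theta) : nat := let: Cell n _ := T in n.

Definition args (T : theta) : 'I_(arity T) -> theta :=
  match T with Cell _ A => A end.

(** An equation between families, not a pointwise one: it can be substituted at once in the types of
    [u] and [v]. *)
Lemma cell_family (I : Type) (S : I -> theta) :
  exists nS (AS : forall i, 'I_(nS i) -> theta), S = fun i => Cell (@AS i).
Proof.
exists (fun i => arity (S i)), (fun i => @args (S i)).
by apply: funext => i; case: (S i).
Qed.

Lemma cyl_preserves (T : theta) (I J : Type) (S : I -> theta) (R : J -> theta)
    (dl dr : J -> I) (u : forall j, incl (R j) (S (dl j)))
    (v : forall j, incl (R j) (S (dr j))) : cyl_preserved u v T.
Proof.
elim: T I J S R dl dr u v => N A IH I J S R dl dr u v.
have [nS [AS eS]] := cell_family S; have [nR [AR eR]] := cell_family R.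
subst S R => iota hT; apply: cyl_step_colimit hT _ => k.
exact: IH.
Qed.

Theorem theorem2p4 (l : nat) (n : 'I_l.+1 -> nat) (m : 'I_l -> nat)
    (hl : forall i : 'I_l, m i <= n (lo i))
    (hr : forall i : 'I_l, m i <= n (hi i))
    (T : theta) (iota : forall i : 'I_l.+1, incl (globe (n i)) T)
    (hT : is_globular_sum hl hr iota) :
  exists phi : functor (colim (cyl_gsum_diag hl hr)) (cyl T),
    is_comparison iota phi /\ is_iso phi.
Proof.
(* The two diagrams of the globular sum are instances of [real_diag] and [cylinder_diag] by
   conversion. *)
have [hc hdesc hext] : @is_colimit (cyl_gsum_diag hl hr) (cyl T)
    (fun i => cyl_incl (iota i)) by apply: cyl_preserves; exact: hT.
(* The inverse is induced by the legs of the chosen colimit; both composites are identities because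
   they are so on the legs. *)
have [psi hpsi] := hdesc _ _ (@leg_cocone (cyl_gsum_diag hl hr)).
exists (desc hc); split; first by move=> i x; apply: (desc_leg hc).
exists psi; split.
  apply: (@colim_ext _ _ (compF psi (desc hc)) (idF _)) => i x.
  by rewrite !compFE desc_leg; apply: hpsi.
apply: (hext _ (compF (desc hc) psi) (idF _)) => i x.
by rewrite !compFE (hpsi i x : psi _ = _) desc_leg.
Qed.
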